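(* Let $\Lambda=kQ/I$ be a bound quiver algebra such that the quiver $Q$ contains a loop. If $\Lambda$ verifies the extension conjecture, then $\Lambda$ is of infinite + global dimension and of infinite co+ global dimension. Consequently $\Lambda$ is a positive answer to the $\tau$ version of Han's conjecture and to the $\tau$ version of Happel's question.
   Context: Let $k$ be a field. All modules and bimodules are finite dimensional over $k$; $D=\mathrm{Hom}_k(-,k)$; $\otimes=\otimes_k$. Bound quiver algebra: $Q$ is a finite quiver with vertex set $Q_0$, $F$ is the ideal of $kQ$ generated by the arrows, $I$ is an admissible ideal ($F^m\subset I\subset F^2$ for some $m\ge 2$), and $\Lambda=kQ/I$. Paths are composed from right to left, so $y\Lambda x$ is spanned by the classes of paths from $x$ to $y$. For $x\in Q_0$, ${}_xk$ (resp. $k_x$) is the simple left (resp. right) $\Lambda$-module at $x$. A graded vector space $V_*$ is infinite if $V_n\neq 0$ for infinitely many $n$. $\Lambda$ verifies the extension conjecture if, whenever there is a loop of $Q$ at a vertex $u$, $\mathrm{Ext}^*_\Lambda({}_uk,{}_uk)$ is infinite (equivalently $\mathrm{Tor}^\Lambda_*(k_u,{}_uk)$ is infinite). $\Lambda$ has infinite + global dimension (resp. infinite co+ global dimension) if there is a pair of vertices $(y,x)$ with $y\Lambda x\neq 0$ and $\mathrm{Tor}^\Lambda_*(k_x,{}_yk)$ infinite (resp. $y\Lambda x\ne 0$ and $\mathrm{Tor}^\Lambda_*(k_y,{}_xk)$ infinite). $\tau$-Hochschild (co)homology: $\Lambda$-bimodules are left $\Lambda\otimes\Lambda^{\mathrm{op}}$-modules,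 and $\mathrm{Hom}_{\Lambda-\Lambda}$ denotes bimodule morphisms. $\Omega^{m}$ is the $m$-th syzygy of bimodules taken with minimal projective resolutions ($\Omega^0=\mathrm{id}$); $\mathrm{Tr}M$ is the transpose, i.e. the cokernel of $\mathrm{Hom}(P_0,\Lambda\otimes\Lambda^{\mathrm{op}})\to\mathrm{Hom}(P_1,\Lambda\otimes\Lambda^{\mathrm{op}})$ for a minimal projective presentation $P_1\to P_0\to M\to 0$; $\tau=D\,\mathrm{Tr}$ for $\Lambda$-bimodules; $\tau_n=\tau\Omega^{n-1}$ for $n\ge1$. For a $\Lambda$-bimodule $X$ and $n\geq 1$: $\mathsf{HH}^n_\tau(\Lambda,X)=D\,\mathrm{Hom}_{\Lambda-\Lambda}(X,\tau_n\Lambda)$ and $\mathsf{HH}_n^\tau(\Lambda,X)=\mathrm{Hom}_{\Lambda-\Lambda}(DX,\tau_n\Lambda)$. An algebra $\Lambda$ of infinite global dimension is a positive answer to the $\tau$ version of Happel's question (resp. of Han's conjecture) if $\mathsf{HH}^*_\tau(\Lambda,\Lambda)$ (resp. $\mathsf{HH}_*^\tau(\Lambda,\Lambda)$) is infinite. *)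

(* Defs.v *)
From HB Require Import structures.
From mathcomp Require Import all_boot all_order all_algebra all_field.
From mathcomp Require Import finmap monalg.
From Stdlib Require Import ClassicalEpsilon.

Set Implicit Arguments.
Unset Strict Implicit.
Unset Printing Implicit Defensive.

Import GRing.Theory.
Local Open Scope ring_scope.

Record quiver := Quiver {
  vertex : finType;
  arrow : finType;
  src : arrow -> vertex;
  tgt : arrow -> vertex }.

Section PathAlgebra.
Variables (k : fieldType) (Q : quiver).

(* A path is its source together with the arrows in the order in which they
   are traversed: a_n ... a_2 a_1 is [:: a_1; a_2; ...; a_n]. *)
Fixpoint composable (x : vertex Q) (s : seq (arrow Q)) : bool :=
  if s is a :: s' then (src a == x) && composable (tgt a) s' else true.

Definition pend (x : vertex Q) (s : seq (arrow Q)) : vertex Q :=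
  last x (map (@tgt Q) s).

Definition qpath : Type :=
  {p : vertex Q * seq (arrow Q) | composable p.1 p.2}.

HB.instance Definition _ := Choice.on qpath.
HB.instance Definition _ := SubType.on qpath.

Definition psrc (p : qpath) : vertex Q := (val p).1.
Definition parr (p : qpath) : seq (arrow Q) := (val p).2.
Definition ptgt (p : qpath) : vertex Q := pend (psrc p) (parr p).

Definition vpath (x : vertex Q) : qpath :=
  exist (fun p => is_true (composable p.1 p.2)) (x, [::]) isT.

Lemma apath_subproof (a : arrow Q) : composable (src a) [:: a].
Proof. by rewrite /= eqxx. Qed.

Definition apath (a : arrow Q) : qpath :=
  exist (fun p => is_true (composable p.1 p.2)) (src a, [:: a])
    (apath_subproof a).

Lemma composable_cat x s t :
  composable x (s ++ t) = composable x s && composable (pend x s) t.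
Proof. by elim: s x => //= a s IHs x; rewrite IHs andbA. Qed.

(* pcomp q p = q p, that is p followed by q. *)
Definition pcomp (q p : qpath) : option qpath :=
  if ptgt p == psrc q then insub (psrc p, parr p ++ parr q) else None.

Lemma pcompE (q p : qpath) : ptgt p = psrc q ->
  exists2 r, pcomp q p = Some r & val r = (psrc p, parr p ++ parr q).
Proof.
move=> pq; rewrite /pcomp pq eqxx; case: insubP => [r _ <-|]; first by exists r.
rewrite /= composable_cat (valP p) /= -[pend _ _]/(ptgt p) pq.
by rewrite (valP q).
Qed.

Lemma pcompN (q p : qpath) : (ptgt p == psrc q) = false -> pcomp q p = None.
Proof. by rewrite /pcomp => ->. Qed.

Lemma psrc_comp q p r : pcomp q p = Some r -> psrc r = psrc p.
Proof.
rewrite /pcomp; case: eqP => // /pcompE [s qp vs]; move: qp.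
rewrite /pcomp; case: eqP => // _ ->; case=> <-.
by rewrite /psrc vs.
Qed.

Lemma ptgt_comp q p r : pcomp q p = Some r -> ptgt r = ptgt q.
Proof.
case: (ptgt p =P psrc q) => [pq|/eqP/negbTE/pcompN -> //].
have [s -> vs] := pcompE pq; case=> <-.
rewrite {1}/ptgt /pend {1}/psrc /parr vs /= map_cat last_cat.
by rewrite -[last (psrc p) _]/(ptgt p) pq.
Qed.

Lemma pcompA (r q p : qpath) :
  obind (pcomp r) (pcomp q p) = obind (fun t => pcomp t p) (pcomp r q).
Proof.
case: (ptgt p =P psrc q) => [pq|npq]; last first.
  rewrite (pcompN (introF eqP npq)) /=.
  case rq: (pcomp r q) => [t|] //=; rewrite pcompN //.
  by apply/eqP; rewrite (psrc_comp rq).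
have [s sE vs] := pcompE pq; rewrite sE /=.
case: (ptgt q =P psrc r) => [qr|nqr]; last first.
  have -> : pcomp r q = None by apply/pcompN/eqP.
  by rewrite pcompN // (ptgt_comp sE); apply/eqP.
have [t tE vt] := pcompE qr; rewrite tE /=.
have sr : ptgt s = psrc r by rewrite (ptgt_comp sE).
have pt : ptgt p = psrc t by rewrite (psrc_comp tE).
have [u -> vu] := pcompE sr; have [v -> vv] := pcompE pt.
congr Some; apply: val_inj; rewrite vu vv.
by rewrite {1}/psrc {1}/parr vs /= [in RHS]/parr vt catA.
Qed.

Lemma pcomp_vl (p : qpath) x :
  pcomp (vpath x) p = if ptgt p == x then Some p else None.
Proof.
case: eqP => [px|np]; last by apply/pcompN/eqP.
have [r -> vr] := @pcompE (vpath x) p px; congr Some; apply: val_inj.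
by rewrite vr cats0 /psrc /parr; case: (val p).
Qed.

Lemma pcomp_vr (p : qpath) x :
  pcomp p (vpath x) = if x == psrc p then Some p else None.
Proof.
case: eqP => [px|np]; last first.
  by apply/pcompN/eqP => px; apply: np.
have [r -> vr] := @pcompE p (vpath x) px; congr Some; apply: val_inj.
by rewrite vr -[psrc (vpath x)]/x px /psrc /parr /=; case: (val p).
Qed.

Lemma trivial_path (p : qpath) : parr p = [::] -> p = vpath (psrc p).
Proof.
move=> pe; apply: val_inj; move: pe; rewrite /parr /psrc /=.
by case: (val p) => y s /= ->.
Qed.

Definition pathalg : Type := {malg k[qpath]}.

HB.instance Definition _ := GRing.Lmodule.on pathalg.

Implicit Types f g h : pathalg.

Definition basisp (p : qpath) : pathalg := << p >>.

Definition basiso (o : option qpath) : pathalg := oapp basisp 0 o.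

Definition pext (V : lmodType k) (F : qpath -> V) (f : pathalg) : V :=
  \sum_(p <- msupp f) mcoeff p f *: F p.

Lemma pextw (V : lmodType k) (F : qpath -> V) f (d : {fset qpath}) :
  (msupp f `<=` d)%fset -> pext F f = \sum_(p <- d) mcoeff p f *: F p.
Proof.
move=> sfd; rewrite /pext; apply: (big_fset_incl _ sfd) => p _ /mcoeff_outdom ->.
by rewrite scale0r.
Qed.

Lemma pext_is_linear (V : lmodType k) (F : qpath -> V) : linear (pext F).
Proof.
move=> c f g.
rewrite (@pextw _ F (c *: f + g) (msupp f `|` msupp g)%fset); last first.
  apply: fsubset_trans (msuppD_le _ _) _.
  by apply: fsetSU; apply: msuppZ_le.
rewrite (@pextw _ F f (msupp f `|` msupp g)%fset) ?fsubsetUl//.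
rewrite (@pextw _ F g (msupp f `|` msupp g)%fset) ?fsubsetUr//.
rewrite scaler_sumr -big_split /=; apply: eq_bigr => p _.
by rewrite mcoeffD mcoeffZ scalerDl scalerA.
Qed.
HB.instance Definition _ (V : lmodType k) (F : qpath -> V) :=
  GRing.isLinear.Build k pathalg V _ (pext F) (pext_is_linear F).

Lemma pextE (V : lmodType k) (F : qpath -> V) p : pext F (basisp p) = F p.
Proof. by rewrite /pext msuppU oner_eq0 big_seq_fset1 mcoeffUU scale1r. Qed.

Lemma pext_uniq (V : lmodType k) (F G : {linear pathalg -> V}) :
  (forall p, F (basisp p) = G (basisp p)) -> F =1 G.
Proof.
move=> FG f.
have -> : f = \sum_(p <- msupp f) mcoeff p f *: basisp p.
  rewrite {1}[f]monalgE; apply: eq_bigr => p _.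
  by apply/malgP => q; rewrite mcoeffZ !mcoeffU mulr_natr.
by rewrite !linear_sum; apply: eq_bigr => p _; rewrite !linearZ FG.
Qed.

Lemma pext_uniqP (V : lmodType k) (F G : pathalg -> V) :
  linear F -> linear G -> (forall p, F (basisp p) = G (basisp p)) -> F =1 G.
Proof.
move=> lF lG.
pose F' : {linear pathalg -> V} :=
  HB.pack F (GRing.isLinear.Build k pathalg V _ F lF).
pose G' : {linear pathalg -> V} :=
  HB.pack G (GRing.isLinear.Build k pathalg V _ G lG).
exact: (@pext_uniq V F' G').
Qed.

(* The product of two paths is their composite, and 0 when they do not compose;
   it is extended bilinearly. *)
Definition pmulp (q : qpath) (g : pathalg) : pathalg :=
  pext (fun p => basiso (pcomp q p)) g.
Definition pmul (f g : pathalg) : pathalg := pext (fun q => pmulp q g) f.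
Definition pone : pathalg := \sum_(x : vertex Q) basisp (vpath x).

Definition pmulr (g f : pathalg) : pathalg := pmul f g.

Lemma pmul_linl g : linear (pmulr g).
Proof. by move=> c f1 f2; rewrite /pmulr /pmul linearP. Qed.
Lemma pmul_linr f : linear (pmul f).
Proof.
move=> c g1 g2; rewrite /pmul /pext scaler_sumr -big_split /=.
apply: eq_bigr => q _; rewrite /pmulp linearP scalerDr !scalerA.
by congr (_ + _); rewrite mulrC.
Qed.
HB.instance Definition _ g :=
  GRing.isLinear.Build k pathalg pathalg _ (pmulr g) (pmul_linl g).
HB.instance Definition _ f :=
  GRing.isLinear.Build k pathalg pathalg _ (pmul f) (pmul_linr f).

Lemma pmulUU p q : pmul (basisp q) (basisp p) = basiso (pcomp q p).
Proof. by rewrite /pmul pextE /pmulp pextE. Qed.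

Lemma pmulUo q o : pmul (basisp q) (basiso o) = basiso (obind (pcomp q) o).
Proof. by case: o => [p|] /=; [rewrite pmulUU | rewrite linear0]. Qed.
Lemma pmuloU p o :
  pmul (basiso o) (basisp p) = basiso (obind (fun q => pcomp q p) o).
Proof.
by case: o => [q|] /=; [rewrite pmulUU | exact: (linear0 (pmulr _))].
Qed.

Lemma pmulA : associative pmul.
Proof.
move=> f g h; move: f.
apply: (@pext_uniq _ (pmulr (pmul g h)) (pmulr h \o pmulr g)) => r /=.
move: g.
apply: (@pext_uniq _ (pmul (basisp r) \o pmulr h)
                     (pmulr h \o pmul (basisp r))) => q /=.
move: h.
apply: (@pext_uniq _ (pmul (basisp r) \o pmul (basisp q))
                     (pmul (pmul (basisp r) (basisp q)))) => p /=.
by rewrite /pmulr !pmulUU pmulUo pmuloU pcompA.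
Qed.

Lemma pmul1l : left_id pone pmul.
Proof.
apply: (@pext_uniq _ (pmul pone) idfun) => p /=.
rewrite /pone -[LHS]/(pmulr _ _) linear_sum (bigD1 (ptgt p)) //= /pmulr.
rewrite pmulUU pcomp_vl eqxx big1 /= ?addr0 // => x.
by rewrite pmulUU pcomp_vl eq_sym => /negbTE ->.
Qed.

Lemma pmul1r : right_id pone pmul.
Proof.
apply: (@pext_uniq _ (pmulr pone) idfun) => p /=.
rewrite /pmulr /pone linear_sum (bigD1 (psrc p)) //=.
rewrite pmulUU pcomp_vr eqxx big1 /= ?addr0 // => x.
by rewrite pmulUU pcomp_vr => /negbTE ->.
Qed.

Lemma pmulDl : left_distributive pmul +%R.
Proof. by move=> f g h; exact: (linearD (pmulr h)). Qed.
Lemma pmulDr : right_distributive pmul +%R.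
Proof. by move=> f g h; exact: linearD. Qed.

HB.instance Definition _ := GRing.Zmodule_isPzRing.Build pathalg
  pmulA pmul1l pmul1r pmulDl pmulDr.

Definition ideal (J : pathalg -> Prop) : Prop :=
  [/\ J 0, forall f g, J f -> J g -> J (f + g)
    & forall f g h, J g -> J (f * g * h)].

Definition ideal_gen (S : pathalg -> Prop) (f : pathalg) : Prop :=
  forall J, ideal J -> (forall g, S g -> J g) -> J f.

Definition ideal_mul (J K : pathalg -> Prop) : pathalg -> Prop :=
  ideal_gen (fun f => exists g h, [/\ J g, K h & f = g * h]).

Fixpoint ideal_exp (J : pathalg -> Prop) (n : nat) : pathalg -> Prop :=
  if n is n'.+1 then ideal_mul J (ideal_exp J n') else fun=> True.

Definition arrow_ideal : pathalg -> Prop :=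
  ideal_gen (fun f => exists a, f = basisp (apath a)).

Definition admissible (I : pathalg -> Prop) : Prop :=
  ideal I /\ exists m : nat, [/\ (2 <= m)%N,
    forall f, ideal_exp arrow_ideal m f -> I f
    & forall f, I f -> ideal_exp arrow_ideal 2 f].

(* The algebra Lambda = kQ / I, given with its projection kQ -> Lambda. *)
Record bound_quiver_algebra := BoundQuiverAlgebra {
  bqa_ideal : pathalg -> Prop;
  bqa_admissible : admissible bqa_ideal;
  bqa_alg :> falgType k;
  bqa_pi : {rmorphism pathalg -> bqa_alg};
  bqa_piZ : scalable bqa_pi;
  bqa_pi_surj : forall a, exists f, bqa_pi f = a;
  bqa_pi_ker : forall f, bqa_pi f = 0 <-> bqa_ideal f }.

Definition loop_at (u : vertex Q) : Prop := exists a, src a = u /\ tgt a = u.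

Definition eps (x : vertex Q) (f : pathalg) : k^o := mcoeff (vpath x) f.

Lemma eps_is_linear x : linear (eps x).
Proof. by move=> c f g; rewrite /eps mcoeffD mcoeffZ. Qed.
HB.instance Definition _ x :=
  GRing.isLinear.Build k pathalg k^o _ (eps x) (eps_is_linear x).

Lemma epsE x p : eps x (basisp p) = (p == vpath x)%:R.
Proof. by rewrite /eps mcoeffU. Qed.

Lemma eps1 x : eps x 1 = 1.
Proof.
rewrite linear_sum (bigD1 x) //= epsE eqxx big1 ?addr0 // => y yx.
rewrite epsE; case: eqP => // /(congr1 psrc) e; move: yx.
by rewrite -[y]/(psrc (vpath y)) e eqxx.
Qed.

Lemma epsM x f g : eps x (f * g) = eps x f * eps x g.
Proof.
have l1 (h : k) : linear (fun f : pathalg => (eps x f : k^o) * h : k^o).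
  by move=> c f1 f2; rewrite linearP /= mulrDl scalerAl.
have l2 (h : k) : linear (fun f : pathalg => h * (eps x f : k^o) : k^o).
  by move=> c f1 f2; rewrite linearP /= mulrDr scalerAr.
move: f; apply: pext_uniqP; [exact: (linearP (eps x \o pmulr g)) | exact: l1 |].
move=> q; move: g; apply: pext_uniqP; [|exact: l2|].
  exact: (linearP (eps x \o pmul (basisp q))).
move=> p; rewrite [basisp q * _]pmulUU !epsE.
case: (ptgt p =P psrc q) => [pq|npq]; last first.
  rewrite (pcompN (introF eqP npq)) /= linear0.
  case: (q =P _) => [qx|_]; last by rewrite mul0r.
  case: (p =P _) => [px|_]; last by rewrite mulr0.
  by case: npq; rewrite qx px.
have [r -> vr] := pcompE pq; rewrite /= epsE -natrM mulnb; congr (_%:R).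
congr nat_of_bool; apply/eqP/andP => [rx|[/eqP qx /eqP px]]; last first.
  by apply: val_inj; rewrite vr qx px.
move: vr; rewrite rx => -[px]; case pe: (parr p) => //; case qe: (parr q) => // _.
have pE : p = vpath x by rewrite (trivial_path pe) -px.
by split; apply/eqP => //; rewrite (trivial_path qe) -pq pE.
Qed.

Lemma eps_kernel_ideal x : ideal (fun f => eps x f = 0).
Proof.
split=> [|f g f0 g0|f g h g0]; first exact: linear0.
  by rewrite linearD /= f0 g0 addr0.
by rewrite !epsM g0 mulr0 mul0r.
Qed.

Lemma eps_admissible I x f : admissible I -> I f -> eps x f = 0.
Proof.
case=> _ [m [_ _ IF]] /IF Ff; apply: (Ff (fun f => eps x f = 0)).
  exact: eps_kernel_ideal.
move=> _ [g [h [Fg _ ->]]]; rewrite epsM.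
suff -> : eps x g = 0 by rewrite mul0r.
apply: (Fg (fun f => eps x f = 0)); first exact: eps_kernel_ideal.
move=> _ [a ->]; rewrite epsE; case: eqP => // /(congr1 (@parr)) //.
Qed.

Section Augmentation.
Variables (L : bound_quiver_algebra) (x : vertex Q).

Definition idem : L := bqa_pi L (basisp (vpath x)).

(* The algebra map Lambda -> k sending e_x to 1, and the other vertices and all
   the arrows to 0. *)
Definition aug (a : L) : k :=
  eps x (proj1_sig (constructive_indefinite_description _ (bqa_pi_surj a))).

Lemma augE f : aug (bqa_pi L f) = eps x f.
Proof.
rewrite /aug; case: constructive_indefinite_description => g /= gf.
have gf0 : bqa_ideal L (g - f) by apply/bqa_pi_ker; rewrite rmorphB gf subrr.
have /eqP := eps_admissible x (bqa_admissible L) gf0.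
by rewrite linearB subr_eq0 => /eqP.
Qed.

Lemma aug_lin c a b : aug (c *: a + b) = c * aug a + aug b.
Proof.
have [f <-] := bqa_pi_surj a; have [g <-] := bqa_pi_surj b.
by rewrite -bqa_piZ -rmorphD !augE linearP.
Qed.
Lemma aug1 : aug 1 = 1.
Proof. by rewrite -(rmorph1 (bqa_pi L)) augE eps1. Qed.
Lemma augM a b : aug (a * b) = aug a * aug b.
Proof.
have [f <-] := bqa_pi_surj a; have [g <-] := bqa_pi_surj b.
by rewrite -rmorphM !augE epsM.
Qed.
End Augmentation.

End PathAlgebra.

Section Vectors.
Variable k : fieldType.
Implicit Types U V W : vectType k.

(* The quotient V / U is realised on the complement U^C; qproj is the
   projection V -> V / U, with kernel U, and qlift a linear section of it. *)
Definition quotv V (U : {vspace V}) : vectType k := subvs_of (U^C)%VS.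

Definition qproj V (U : {vspace V}) : 'Hom(V, quotv U) :=
  (linfun (@vsproj _ _ (U^C)%VS) \o daddv_pi (U^C)%VS U)%VF.

Definition qlift V (U : {vspace V}) : 'Hom(quotv U, V) :=
  linfun (@vsval _ _ (U^C)%VS).

Lemma cap_complv V (U : {vspace V}) : (U^C :&: U = 0)%VS.
Proof. by rewrite capvC capv_compl. Qed.

Lemma qliftK V (U : {vspace V}) : cancel (qlift U) (qproj U).
Proof.
move=> q; rewrite /qproj comp_lfunE /qlift !lfunE /=.
rewrite daddv_pi_id ?cap_complv ?subvsP //.
exact: vsvalK.
Qed.

Lemma qprojK V (U : {vspace V}) v : v - qlift U (qproj U v) \in U.
Proof.
rewrite /qproj comp_lfunE /qlift !lfunE /= vsprojK ?memv_pi //.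
have vUC : v \in (U^C + U)%VS by rewrite addvC addv_complf memvf.
have {1}-> := esym (daddv_pi_add (cap_complv U) vUC).
by rewrite addrC addKr memv_pi.
Qed.

Lemma qproj_eq0 V (U : {vspace V}) v : (qproj U v == 0) = (v \in U).
Proof.
apply/eqP/idP => [v0|vU].
  by have := qprojK U v; rewrite v0 linear0 subr0.
apply: (can_inj (@qliftK _ U)); rewrite linear0.
have : qlift U (qproj U v) \in (U^C :&: U)%VS.
  apply/memv_capP; split; first by rewrite /qlift lfunE /= subvsP.
  have -> : qlift U (qproj U v) = v - (v - qlift U (qproj U v)).
    by rewrite opprB addrCA subrr addr0.
  exact: memvB vU (qprojK U v).
by rewrite cap_complv memv0 => /eqP.
Qed.

Lemma qproj_eq V (U : {vspace V}) v w : v - w \in U -> qproj U v = qproj U w.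
Proof. by rewrite -qproj_eq0 linearB subr_eq0 => /eqP. Qed.

Definition homology U V W (f : 'Hom(U, V)) (g : 'Hom(V, W)) : vectType k :=
  subvs_of (lker g :\: limg f)%VS.

Definition vb V (i : 'I_(\dim {:V})) : V := (vbasis {:V})`_i.
Definition vc V (i : 'I_(\dim {:V})) (v : V) : k := coord (vbasis {:V}) i v.

Lemma vbE V (v : V) : v = \sum_i vc i v *: vb i.
Proof. by apply: coord_vbasis; rewrite memvf. Qed.

(* V (x) W, with coordinates on the basis of the vb i (x) vb j. *)
Definition tens V W : vectType k := 'M[k]_(\dim {:V}, \dim {:W}).

Definition tprod V W (v : V) (w : W) : tens V W :=
  \matrix_(i, j) (vc i v * vc j w).

Definition text V W U (F : V -> W -> U) (t : tens V W) : U :=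
  \sum_i \sum_j (t : 'M_(_, _)) i j *: F (vb i) (vb j).

Lemma text_is_linear V W U (F : V -> W -> U) : linear (text F).
Proof.
move=> c s t; rewrite scaler_sumr -big_split /=; apply: eq_bigr => i _.
rewrite scaler_sumr -big_split /=; apply: eq_bigr => j _.
by rewrite !mxE scalerDl scalerA.
Qed.
HB.instance Definition _ V W U (F : V -> W -> U) :=
  GRing.isLinear.Build k (tens V W) U _ (text F) (text_is_linear F).

Definition bilinear V W U (F : V -> W -> U) : Prop :=
  (forall w, linear (F^~ w)) /\ (forall v, linear (F v)).

Lemma linear_expand V U (f : V -> U) : linear f ->
  forall v, f v = \sum_i vc i v *: f (vb i).
Proof.
move=> lf v; pose F := GRing.isLinear.Build k V U _ f lf.
pose f' : {linear V -> U} := HB.pack f F.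
rewrite {1}[v]vbE; have /= := @linear_sum _ _ _ _ f'.
move=> -> ; apply: eq_bigr => i _.
by have /= := @linearZ_LR _ _ _ _ f'; move=> ->.
Qed.

Lemma textE V W U (F : V -> W -> U) : bilinear F ->
  forall v w, text F (tprod v w) = F v w.
Proof.
move=> [Fl Fr] v w; rewrite (linear_expand (Fl w)); apply: eq_bigr => i _.
rewrite (linear_expand (Fr _)) scaler_sumr; apply: eq_bigr => j _.
by rewrite mxE scalerA.
Qed.

Lemma tens_expand V W (t : tens V W) :
  t = \sum_i \sum_j (t : 'M_(_, _)) i j *: tprod (vb i) (vb j).
Proof.
have vcb (T : vectType k) (i j : 'I_(\dim {:T})) : vc i (vb j) = (i == j)%:R.
  by rewrite /vc /vb coord_free ?(basis_free (vbasisP _)) // eq_sym.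
apply/matrixP => i j; rewrite summxE (bigD1 i) //= summxE (bigD1 j) //=.
rewrite !mxE !vcb !eqxx !mulr1 !big1 ?addr0 //.
  move=> i' ii'; rewrite summxE big1 // => j' _.
  by rewrite !mxE !vcb eq_sym (negbTE ii') mul0r mulr0.
by move=> j' jj'; rewrite !mxE !vcb [j == _]eq_sym (negbTE jj') !mulr0.
Qed.

Lemma tens_uniq V W U (f g : tens V W -> U) : linear f -> linear g ->
  (forall v w, f (tprod v w) = g (tprod v w)) -> f =1 g.
Proof.
move=> lf lg fg t.
pose f' : {linear tens V W -> U} := HB.pack f (GRing.isLinear.Build k _ U _ f lf).
pose g' : {linear tens V W -> U} := HB.pack g (GRing.isLinear.Build k _ U _ g lg).
rewrite -[LHS]/(f' t) -[RHS]/(g' t) [t]tens_expand !linear_sum.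
apply: eq_bigr => i _; rewrite !linear_sum; apply: eq_bigr => j _.
by rewrite !linearZ /= fg.
Qed.

Lemma linfunE V W (f : V -> W) : linear f -> linfun f =1 f.
Proof.
move=> lf v.
pose f' : {linear V -> W} := HB.pack f (GRing.isLinear.Build k V W _ f lf).
exact: (lfunE f').
Qed.

Lemma tprod_bilinear V W : bilinear (@tprod V W).
Proof.
split=> [w c v1 v2|v c w1 w2]; apply/matrixP => i j; rewrite !mxE /vc linearP /=.
  by rewrite mulrDl mulrA.
by rewrite mulrDr mulrCA.
Qed.

End Vectors.

(* The enveloping algebra L (x) L^op: (a (x) b)(c (x) d) = ac (x) db. *)
Section Enveloping.
Variables (k : fieldType) (L : falgType k).

Definition env : Type := tens L L.
HB.instance Definition _ := Vector.copy env (tens L L).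

Definition emul (s t : env) : env :=
  text (fun a b => text (fun c d => tprod (a * c) (d * b)) t) s.
Definition eone : env := tprod 1 1.

Lemma mulr_tprod_bilinear (a b : L) :
  bilinear (fun c d : L => tprod (a * c) (d * b)).
Proof.
have [tl tr] := tprod_bilinear L L.
split=> [d e x y|c e x y] /=.
  by rewrite mulrDr -scalerAr tl.
by rewrite mulrDl -scalerAl tr.
Qed.

Lemma mull_tprod_bilinear (c d : L) :
  bilinear (fun a b : L => tprod (a * c) (d * b)).
Proof.
have [tl tr] := tprod_bilinear L L.
split=> [b e x y|a e x y] /=.
  by rewrite mulrDl -scalerAl tl.
by rewrite mulrDr -scalerAr tr.
Qed.

Lemma text_bilinear (V W U X Y : vectType k) (F : X -> Y -> V -> W -> U) t :
  (forall v w, bilinear (fun x y => F x y v w)) ->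
  bilinear (fun x y => text (F x y) t).
Proof.
move=> bF; split=> [y c x1 x2|x c y1 y2]; rewrite /text scaler_sumr -big_split;
  apply: eq_bigr => i _; rewrite scaler_sumr -big_split; apply: eq_bigr => j _;
  have [Fl Fr] := bF (vb i) (vb j).
  by rewrite /= Fl scalerDr !scalerA mulrC.
by rewrite /= Fr scalerDr !scalerA mulrC.
Qed.

Lemma emul_linl t : linear (emul^~ t).
Proof. by move=> c s1 s2; rewrite /emul linearP. Qed.

Lemma emul_linr s : linear (emul s).
Proof.
move=> c t1 t2; rewrite /emul /text [in RHS]scaler_sumr -big_split.
apply: eq_bigr => i _; rewrite [in RHS]scaler_sumr -big_split.
apply: eq_bigr => j _ /=.
rewrite -![\sum_i0 \sum_j0 _]/(text (fun c d => tprod (vb i * c) (d * vb j)) _).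
by rewrite linearP scalerDr !scalerA mulrC.
Qed.

Lemma emulE a b c d : emul (tprod a b) (tprod c d) = tprod (a * c) (d * b).
Proof.
rewrite /emul textE; first by rewrite textE //; exact: mulr_tprod_bilinear.
by apply: text_bilinear => c' d'; exact: mull_tprod_bilinear.
Qed.

Lemma emulA : associative emul.
Proof.
move=> s t u; move: s.
apply: tens_uniq => [c s1 s2|c s1 s2|a b]; rewrite ?emul_linl //; move: t.
apply: tens_uniq => [e t1 t2|e t1 t2|c d]; rewrite ?(emul_linl, emul_linr) //.
move: u; apply: tens_uniq => [x t1 t2|x t1 t2|e f]; rewrite ?emul_linr //.
by rewrite !emulE !mulrA.
Qed.

Lemma emul1l : left_id eone emul.
Proof.
apply: tens_uniq => [c s t|//|a b]; first by rewrite emul_linr.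
by rewrite emulE mul1r mulr1.
Qed.

Lemma emul1r : right_id eone emul.
Proof.
apply: tens_uniq => [c s t|//|a b]; first by rewrite emul_linl.
by rewrite emulE mul1r mulr1.
Qed.

Lemma emulDl : left_distributive emul +%R.
Proof.
by move=> s t u; have := emul_linl u 1 s t; rewrite /= !scale1r.
Qed.
Lemma emulDr : right_distributive emul +%R.
Proof.
by move=> s t u; have := emul_linr s 1 t u; rewrite /= !scale1r.
Qed.

Lemma eone_neq0 : eone != 0.
Proof.
have [i vi] : exists i, vc i (1 : L) != 0.
  apply/existsP; apply: contraT; rewrite negb_exists => /forallP v0.
  have /eqP := oner_neq0 L; case; rewrite [LHS]vbE big1 // => i _.
  by have := v0 i; rewrite negbK => /eqP ->; rewrite scale0r.
apply/eqP => /matrixP /(_ i i) /eqP; rewrite !mxE mulf_eq0 orbb.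
exact/negP.
Qed.

HB.instance Definition _ := GRing.Zmodule_isNzRing.Build env
  emulA emul1l emul1r emulDl emulDr eone_neq0.

Lemma emulZl (c : k) (s t : env) : c *: (s * t) = (c *: s) * t.
Proof.
have z : emul 0 t = 0 := mul0r t.
by have := emul_linl t c s 0; rewrite /= z !addr0.
Qed.
HB.instance Definition _ := GRing.Lmodule_isLalgebra.Build k env emulZl.

Lemma emulZr (c : k) (s t : env) : c *: (s * t) = s * (c *: t).
Proof.
have z : emul s 0 = 0 := mulr0 s.
by have := emul_linr s c t 0; rewrite /= z !addr0.
Qed.
HB.instance Definition _ := GRing.Lalgebra_isAlgebra.Build k env emulZr.
HB.instance Definition _ := Algebra_isFalgebra.Build k env.

End Enveloping.

Section Modules.
Variables (k : fieldType) (B : falgType k).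

Record lmod := Lmod {
  lcar :> vectType k;
  lact : B -> 'End(lcar);
  lact_lin : linear lact;
  lact1 : lact 1 = \1%VF;
  lactM : forall a b, lact (a * b) = (lact a \o lact b)%VF }.

Record rmod := Rmod {
  rcar :> vectType k;
  ract : B -> 'End(rcar);
  ract_lin : linear ract;
  ract1 : ract 1 = \1%VF;
  ractM : forall a b, ract (a * b) = (ract b \o ract a)%VF }.

Definition is_hom (M N : lmod) (f : 'Hom(M, N)) : Prop :=
  forall b x, f (lact M b x) = lact N b (f x).

Lemma lactMv (M : lmod) a b (x : M) : lact M (a * b) x = lact M a (lact M b x).
Proof. by rewrite lactM comp_lfunE. Qed.

Lemma lact1v (M : lmod) (x : M) : lact M 1 x = x.
Proof. by rewrite lact1 id_lfunE. Qed.

Lemma ractMv (M : rmod) a b (x : M) : ract M (a * b) x = ract M b (ract M a x).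
Proof. by rewrite ractM comp_lfunE. Qed.

Lemma ract1v (M : rmod) (x : M) : ract M 1 x = x.
Proof. by rewrite ract1 id_lfunE. Qed.

Lemma lact_linv (M : lmod) (x : M) : linear (fun b => lact M b x).
Proof. by move=> c a b; rewrite lact_lin add_lfunE scale_lfunE. Qed.

Lemma ract_linv (M : rmod) (x : M) : linear (fun b => ract M b x).
Proof. by move=> c a b; rewrite ract_lin add_lfunE scale_lfunE. Qed.

(* Hom_B(M, N); by linearity it suffices to commute with a basis of B. *)
Definition homs_defect (M N : lmod) (b : B) (f : 'Hom(M, N)) : 'Hom(M, N) :=
  ((f \o lact M b) - (lact N b \o f))%VF.

Definition homs (M N : lmod) : {vspace 'Hom(M, N)} :=
  (\bigcap_(i < \dim {:B}) lker (linfun (@homs_defect M N (vb i))))%VS.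

Lemma homs_defect_lin M N b : linear (@homs_defect M N b).
Proof.
move=> c f g; apply/lfunP => x; rewrite /homs_defect.
rewrite !(add_lfunE, opp_lfunE, comp_lfunE, scale_lfunE) linearP scalerBr opprD.
by rewrite addrACA.
Qed.

Lemma homsP (M N : lmod) (f : 'Hom(M, N)) : f \in homs M N <-> is_hom f.
Proof.
have E b : homs_defect b f = 0 <-> forall x, f (lact M b x) = lact N b (f x).
  split=> [/lfunP f0 x|fb].
    have := f0 x; rewrite /homs_defect !(add_lfunE, opp_lfunE, comp_lfunE).
    by rewrite zero_lfunE => /eqP; rewrite subr_eq0 => /eqP.
  apply/lfunP => x; rewrite /homs_defect !(add_lfunE, opp_lfunE, comp_lfunE).
  by rewrite fb subrr zero_lfunE.
rewrite memvE; split=> [/subv_bigcapP fi b x|hf].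
  rewrite (linear_expand (lact_linv x) b) (linear_expand (lact_linv (f x)) b).
  rewrite linear_sum; apply: eq_bigr => i _; rewrite linearZ /=; congr (_ *: _).
  move: x; apply/E; have := fi i isT; rewrite -memvE memv_ker linfunE.
    by move/eqP.
  exact: homs_defect_lin.
apply/subv_bigcapP => i _; rewrite -memvE memv_ker linfunE.
  by apply/eqP/E => x; apply: hf.
exact: homs_defect_lin.
Qed.

Definition smod (M : lmod) (U : {vspace M}) : Prop :=
  forall b x, x \in U -> lact M b x \in U.

Definition incl (V : vectType k) (U : {vspace V}) : 'Hom(subvs_of U, V) :=
  linfun vsval.
Definition corestr (V : vectType k) (U : {vspace V}) : 'Hom(V, subvs_of U) :=
  linfun (vsproj U).

Lemma inclE (V : vectType k) (U : {vspace V}) u : incl U u = vsval u.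
Proof. by rewrite /incl lfunE. Qed.
Lemma incl_in (V : vectType k) (U : {vspace V}) u : incl U u \in U.
Proof. by rewrite inclE subvsP. Qed.
Lemma incl_inj (V : vectType k) (U : {vspace V}) : injective (incl U).
Proof. by move=> u v; rewrite !inclE => /subvs_inj. Qed.
Lemma corestrK (V : vectType k) (U : {vspace V}) v :
  v \in U -> incl U (corestr U v) = v.
Proof. by move=> vU; rewrite inclE /corestr lfunE vsprojK. Qed.

Section Submodule.
Variables (M : lmod) (U : {vspace M}) (sU : smod U).

Definition sub_act (b : B) : 'End(subvs_of U) :=
  (corestr U \o lact M b \o incl U)%VF.

Lemma sub_actE b u : incl U (sub_act b u) = lact M b (incl U u).
Proof. by rewrite /sub_act !comp_lfunE corestrK // sU ?incl_in. Qed.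

Lemma sub_act_lin : linear sub_act.
Proof.
move=> c a b; apply/lfunP => u; apply: (@incl_inj _ U).
rewrite sub_actE lact_lin !(add_lfunE, scale_lfunE) linearP /=.
by rewrite !sub_actE.
Qed.

Lemma sub_act1 : sub_act 1 = \1%VF.
Proof. by apply/lfunP => u; apply: (@incl_inj _ U); rewrite sub_actE lact1 !id_lfunE. Qed.

Lemma sub_actM a b : sub_act (a * b) = (sub_act a \o sub_act b)%VF.
Proof.
apply/lfunP => u; apply: (@incl_inj _ U).
by rewrite comp_lfunE !sub_actE lactMv.
Qed.

Definition submod : lmod := Lmod sub_act_lin sub_act1 sub_actM.
End Submodule.

Lemma ker_smod (M N : lmod) (f : 'Hom(M, N)) : is_hom f -> smod (lker f).
Proof.
by move=> hf b x; rewrite !memv_ker hf => /eqP ->; rewrite linear0.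
Qed.

Lemma img_smod (M N : lmod) (f : 'Hom(M, N)) : is_hom f -> smod (limg f).
Proof. by move=> hf b _ /memv_imgP[x _ ->]; rewrite -hf memv_img ?memvf. Qed.

Definition kermod (M N : lmod) (f : 'Hom(M, N)) (hf : is_hom f) : lmod :=
  submod (ker_smod hf).

Definition projective (P : lmod) : Prop :=
  forall (M N : lmod) (g : 'Hom(M, N)) (f : 'Hom(P, N)),
    is_hom g -> limg g = fullv -> is_hom f ->
    exists2 h : 'Hom(P, M), is_hom h & (g \o h)%VF = f.

Section Free.
Variable V : vectType k.

Definition free_act (b : B) : 'End(tens B V) :=
  linfun (text (fun a v => tprod (b * a) v)).

Lemma free_act_bil b : bilinear (fun (a : B) (v : V) => tprod (b * a) v).
Proof.
have [tl tr] := tprod_bilinear B V.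
by split=> [v c x y|a c x y] /=; rewrite ?mulrDr -?scalerAr ?tl ?tr.
Qed.

Lemma free_actE b a v : free_act b (tprod a v) = tprod (b * a) v.
Proof. by rewrite /free_act lfunE /= textE //; exact: free_act_bil. Qed.

Lemma free_act_lin : linear free_act.
Proof.
have [tl _] := tprod_bilinear B V.
move=> c a b; apply/lfunP; apply: tens_uniq => [||x v]; try exact: linearP.
by rewrite add_lfunE scale_lfunE !free_actE mulrDl -scalerAl tl.
Qed.

Lemma free_act1 : free_act 1 = \1%VF.
Proof.
apply/lfunP; apply: tens_uniq => [||x v]; try exact: linearP.
by rewrite free_actE mul1r id_lfunE.
Qed.

Lemma free_actM a b : free_act (a * b) = (free_act a \o free_act b)%VF.
Proof.
apply/lfunP; apply: tens_uniq => [||x v]; try exact: linearP.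
by rewrite comp_lfunE !free_actE mulrA.
Qed.

Definition freemod : lmod := Lmod free_act_lin free_act1 free_actM.

Definition free_ext (M : lmod) (f : 'Hom(V, M)) : 'Hom(freemod, M) :=
  linfun (text (fun b v => lact M b (f v))).

Lemma free_extE (M : lmod) (f : 'Hom(V, M)) b v :
  free_ext f (tprod b v) = lact M b (f v).
Proof.
rewrite /free_ext lfunE /= textE //; split=> [w c x y|a c x y] /=.
  exact: lact_linv.
by rewrite !linearP.
Qed.

Lemma free_ext_hom (M : lmod) (f : 'Hom(V, M)) : is_hom (free_ext f).
Proof.
move=> b; apply: tens_uniq => [c s t|c s t|a v]; try by rewrite !linearP.
by rewrite -[lact freemod b _]/(free_act b _) free_actE !free_extE lactMv.
Qed.

Lemma free_projective : projective freemod.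
Proof.
move=> M N g f hg sg hf.
have tl : linear (@tprod _ B V 1) by case: (tprod_bilinear B V) => _; apply.
pose h0 : 'Hom(V, M) := (g^-1 \o f \o linfun (@tprod _ B V 1))%VF.
exists (free_ext h0); first exact: free_ext_hom.
apply/lfunP; apply: tens_uniq => [||b v]; try exact: linearP.
rewrite comp_lfunE free_extE hg /h0 !comp_lfunE limg_lfunVK ?sg ?memvf //.
by rewrite (linfunE tl) -hf -[lact freemod b _]/(free_act b _) free_actE mulr1.
Qed.
End Free.

Record projcover (M : lmod) := ProjCover {
  pc_mod : lmod;
  pc_map : 'Hom(pc_mod, M);
  pc_projective : projective pc_mod;
  pc_hom : is_hom pc_map;
  pc_surj : limg pc_map = fullv;
  pc_superfluous : forall U : {vspace pc_mod},
    smod U -> (U + lker pc_map)%VS = fullv -> U = fullv }.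

Lemma ex_min (P : nat -> Prop) : (exists n, P n) ->
  exists2 n, P n & forall m, P m -> (n <= m)%N.
Proof.
case=> n; elim/ltn_ind: n => n IHn Pn.
have [[m [mn Pm]]|nm] := excluded_middle_informative (exists m, (m < n)%N /\ P m).
  exact: IHn Pm.
exists n => // m Pm; rewrite leqNgt; apply/negP => mn.
by apply: nm; exists m.
Qed.

Lemma comp_hom (M N P : lmod) (g : 'Hom(N, P)) (f : 'Hom(M, N)) :
  is_hom g -> is_hom f -> is_hom (g \o f)%VF.
Proof. by move=> hg hf b x; rewrite !comp_lfunE hf hg. Qed.

Lemma incl_hom (M : lmod) (U : {vspace M}) (sU : smod U) :
  is_hom (incl U : 'Hom(submod sU, M)).
Proof. by move=> b x; rewrite [LHS]sub_actE. Qed.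

Arguments incl_hom {M U} sU.

(* A module generated by dim M elements covers M; a projective module of least
   dimension which surjects onto M is a projective cover. *)
Lemma projcover_exists (M : lmod) : inhabited (projcover M).
Proof.
pose S n := exists (P : lmod) (f : 'Hom(P, M)),
  [/\ projective P, is_hom f, limg f = fullv & \dim {:P} = n].
have [|n [P [f [pP hf sf dP]]] minP] := @ex_min S.
  exists (\dim {:freemod M}), (freemod M), (free_ext \1%VF); split=> //.
  - exact: free_projective.
  - exact: free_ext_hom.
  apply/eqP; rewrite eqEsubv subvf; apply/subvP => x _.
  apply/memv_imgP; exists (tprod 1 x); first exact: memvf.
  by rewrite free_extE lact1v id_lfunE.
constructor; apply: (@ProjCover _ P f pP hf sf) => U sU UK.
pose E n := exists e : 'End(P),
  [/\ is_hom (e : 'Hom(P, P)), (f \o e)%VF = f, (limg e <= U)%VS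
    & \dim (limg e) = n].
have [|d [e [he fe eU de]] minE] := @ex_min E.
  have hfU := comp_hom hf (incl_hom sU).
  have [|h hh fh] := pP (submod sU) M _ f hfU _ hf.
    apply/eqP; rewrite eqEsubv subvf; apply/subvP => y _.
    have : y \in limg f by rewrite sf memvf.
    case/memv_imgP => x _ ->.
    have : x \in (U + lker f)%VS by rewrite UK memvf.
    case/memv_addP => u uU [v]; rewrite memv_ker => /eqP fv ->.
    rewrite linearD /= fv addr0; apply/memv_imgP.
    by exists (corestr U u); rewrite ?memvf // comp_lfunE corestrK.
  exists (\dim (limg (incl U \o h)%VF)), (incl U \o h)%VF; split=> //.
  - exact: comp_hom (incl_hom sU) hh.
  - by rewrite comp_lfunA.
  by apply/subvP => _ /memv_imgP[x _ ->]; rewrite comp_lfunE incl_in.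
pose W := limg e.
have eW : (e @: W)%VS = W.
  have ee : limg (e \o e)%VF = (e @: W)%VS by rewrite limg_comp.
  apply/eqP; rewrite eqEdim limgS ?subvf //= de -ee; apply: minE.
  exists (e \o e)%VF; split=> //; first exact: comp_hom.
    by rewrite comp_lfunA fe.
  by rewrite ee; apply: subv_trans eU; rewrite limgS ?subvf.
have sW : smod W by apply: img_smod.
pose r : 'Hom(P, submod sW) := (corestr W \o e)%VF.
have rE x : incl W (r x) = e x by rewrite /r comp_lfunE corestrK ?memv_img ?memvf.
have hr : is_hom r.
  move=> b x; apply: (@incl_inj _ W); rewrite [RHS]sub_actE //.
  by rewrite !rE he.
pose q : 'End(submod sW) := (r \o incl W)%VF.
have hq : is_hom q by apply: comp_hom => //; apply: incl_hom.
have q0 : lker q == 0%VS.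
  rewrite -dimv_eq0 -(eqn_add2r (\dim (limg q))) add0n.
  have := limg_ker_dim q fullv; rewrite capfv => ->; apply/eqP; congr (\dim _).
  apply/eqP; rewrite eqEsubv subvf andbT; apply/subvP => w _.
  have : incl W w \in (e @: W)%VS by rewrite eW incl_in.
  case/memv_imgP => x xW ex; apply/memv_imgP; exists (corestr W x).
    exact: memvf.
  by apply: (@incl_inj _ W); rewrite /q comp_lfunE rE corestrK.
pose p : 'Hom(P, submod sW) := (q^-1 \o r)%VF.
have hqV : is_hom (q^-1 : 'Hom(submod sW, submod sW))%VF.
  move=> b x; have /lker0P := q0; apply; rewrite hq.
  by rewrite !lker0_lfunVK.
have pW : projective (submod sW).
  move=> X Y g h hg sg hh.
  have [|h' hh' gh'] := pP X Y g (h \o p)%VF hg sg.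
    exact/comp_hom/comp_hom.
  exists (h' \o incl W)%VF; first exact: comp_hom hh' (incl_hom sW).
  have pi : (p \o incl W)%VF = \1%VF by rewrite /p -comp_lfunA; exact: lker0_compVf.
  by rewrite comp_lfunA gh' -comp_lfunA pi comp_lfun1r.
have : (n <= \dim {:submod sW})%N.
  apply: minP; exists (submod sW), (f \o incl W)%VF; split=> //.
    exact: comp_hom hf (incl_hom sW).
  apply/eqP; rewrite eqEsubv subvf; apply/subvP => y _.
  have : y \in limg f by rewrite sf memvf.
  case/memv_imgP => x _ ->; apply/memv_imgP; exists (r x); first exact: memvf.
  by rewrite comp_lfunE rE -comp_lfunE fe.
rewrite -dP => dW; apply/eqP; rewrite eqEsubv subvf; apply: subv_trans eU.
have dWE : \dim {:submod sW} = \dim W by rewrite dimvf.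
by rewrite -/W; have := eqEdim W {:P}; rewrite subvf -dWE dW => /eqP ->.
Qed.

Arguments pc_hom {M} p.

(* A chosen projective cover, which is unique up to isomorphism. *)
Definition pcover (M : lmod) : projcover M :=
  epsilon (projcover_exists M) (fun=> True).

Definition Omega (M : lmod) : lmod := kermod (pc_hom (pcover M)).

Fixpoint syz (n : nat) (M : lmod) : lmod :=
  if n is n'.+1 then Omega (syz n' M) else M.

(* The minimal projective resolution
   ... -> mres M 2 -> mres M 1 -> mres M 0 -> M -> 0. *)
Definition mres (M : lmod) (n : nat) : lmod := pc_mod (pcover (syz n M)).

Definition mdiff (M : lmod) (n : nat) : 'Hom(mres M n.+1, mres M n) :=
  (incl (lker (pc_map (pcover (syz n M)))) \o pc_map (pcover (syz n.+1 M)))%VF.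

Lemma mdiff_hom M n : is_hom (mdiff M n).
Proof.
exact: (comp_hom (incl_hom (ker_smod (pc_hom (pcover (syz n M)))))
                 (pc_hom (pcover (syz n.+1 M)))).
Qed.

(* pdim_le n M: there is an exact sequence 0 -> P_n -> ... -> P_0 -> M -> 0
   with all P_i projective. *)
Inductive pdim_le : nat -> lmod -> Prop :=
| pdim_le0 M : projective M -> pdim_le 0 M
| pdim_leS n (P M : lmod) (f : 'Hom(P, M)) (hf : is_hom f) :
    projective P -> limg f = fullv -> pdim_le n (kermod hf) -> pdim_le n.+1 M.

Definition infinite_gldim : Prop := forall n, exists M, ~ pdim_le n M.

(* f |-> f \o d, from Hom_B(P, N) to Hom_B(P', N). *)
Definition precomp (P P' N : lmod) (d : 'Hom(P', P)) :
    'Hom(subvs_of (homs P N), subvs_of (homs P' N)) :=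
  linfun (fun f => vsproj (homs P' N) (vsval f \o d)%VF).

Lemma precompE (P P' N : lmod) (d : 'Hom(P', P)) : is_hom d ->
  forall f, vsval (precomp N d f) = (vsval f \o d)%VF.
Proof.
move=> hd f; rewrite /precomp linfunE.
  by rewrite vsprojK //; apply/homsP/comp_hom => //; apply/homsP/subvsP.
move=> c g h; rewrite -linearP; congr (vsproj _ _).
by rewrite linearP /= comp_lfunDl comp_lfunZl.
Qed.

Definition Ext (n : nat) (M N : lmod) : vectType k :=
  if n is n'.+1
  then homology (precomp N (mdiff M n')) (precomp N (mdiff M n'.+1))
  else homology (0 : 'Hom(k^o, _)) (precomp N (mdiff M 0)).

(* X (x)_B P is the quotient of X (x) P by the span of the
   x b (x) p - x (x) b p, with x, b, p running through bases. *)
Definition tensor_rel (X : rmod) (P : lmod) : {vspace tens X P} :=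
  (\sum_(i < \dim {:X}) \sum_(b < \dim {:B}) \sum_(j < \dim {:P})
     <[tprod (ract X (vb b) (vb i)) (vb j : P)
       - tprod (vb i : X) (lact P (vb b) (vb j))]>)%VS.

Definition tensor (X : rmod) (P : lmod) : vectType k := quotv (tensor_rel X P).

Definition tensor_map (X : rmod) (P P' : lmod) (d : 'Hom(P', P)) :
    'Hom(tensor X P', tensor X P) :=
  (qproj (tensor_rel X P)
     \o linfun (text (fun x p => tprod x (d p)))
     \o qlift (tensor_rel X P'))%VF.

Definition Tor (n : nat) (X : rmod) (M : lmod) : vectType k :=
  if n is n'.+1
  then homology (tensor_map X (mdiff M n'.+1)) (tensor_map X (mdiff M n'))
  else homology (tensor_map X (mdiff M 0)) (0 : 'Hom(_, k^o)).

Section RightQuotient.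
Variables (X : rmod) (U : {vspace X}).
Hypothesis sU : forall b x, x \in U -> ract X b x \in U.

Definition quot_act (b : B) : 'End(quotv U) :=
  (qproj U \o ract X b \o qlift U)%VF.

Lemma quot_actE b x : quot_act b (qproj U x) = qproj U (ract X b x).
Proof.
have -> : quot_act b (qproj U x) = qproj U (ract X b (qlift U (qproj U x))).
  by rewrite /quot_act !comp_lfunE.
apply: esym; apply: qproj_eq.
by have := sU b (qprojK U x); rewrite linearB.
Qed.

Lemma quot_ind (P : quotv U -> Prop) : (forall x, P (qproj U x)) -> forall q, P q.
Proof. by move=> Pq q; rewrite -[q](@qliftK _ _ U). Qed.

Lemma quot_act_lin : linear quot_act.
Proof.
move=> c a b; apply/lfunP; apply: quot_ind => x.
by rewrite add_lfunE scale_lfunE !quot_actE ract_linv linearP.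
Qed.

Lemma quot_act1 : quot_act 1 = \1%VF.
Proof. by apply/lfunP; apply: quot_ind => x; rewrite quot_actE ract1 !id_lfunE. Qed.

Lemma quot_actM a b : quot_act (a * b) = (quot_act b \o quot_act a)%VF.
Proof.
apply/lfunP; apply: quot_ind => x.
by rewrite comp_lfunE !quot_actE ractMv.
Qed.

Definition rquot : rmod := Rmod quot_act_lin quot_act1 quot_actM.
End RightQuotient.

Lemma amulrE (b x : B) : amulr b x = x * b.
Proof. by rewrite /amulr lfunE. Qed.

Definition reg_act (b : B) : 'End(B) := amull b.
Lemma reg_actE b x : reg_act b x = b * x.
Proof. by rewrite /reg_act /amull lfunE. Qed.
Lemma reg_act_lin : linear reg_act.
Proof.
move=> c a b; apply/lfunP => x.
by rewrite add_lfunE scale_lfunE !reg_actE mulrDl scalerAl.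
Qed.
Lemma reg_act1 : reg_act 1 = \1%VF.
Proof. by apply/lfunP => x; rewrite reg_actE mul1r id_lfunE. Qed.
Lemma reg_actM a b : reg_act (a * b) = (reg_act a \o reg_act b)%VF.
Proof. by apply/lfunP => x; rewrite comp_lfunE !reg_actE mulrA. Qed.
Definition regmod : lmod := Lmod reg_act_lin reg_act1 reg_actM.

(* Hom_B(P, B) with (f b)(p) = f(p) b. *)
Section Star.
Variable P : lmod.

Definition star_act (b : B) : 'End(subvs_of (homs P regmod)) :=
  linfun (fun f => vsproj (homs P regmod) (amulr b \o vsval f)%VF).

Lemma star_actE b f p : vsval (star_act b f) p = vsval f p * b.
Proof.
rewrite /star_act linfunE.
  rewrite vsprojK ?comp_lfunE ?amulrE //; apply/homsP => c x.
  rewrite !comp_lfunE !amulrE.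
  have /homsP -> := subvsP f.
  by rewrite -![lact regmod c _]/(reg_act c _) !reg_actE mulrA.
move=> c g h; rewrite -linearP; congr (vsproj _ _).
by rewrite linearP /= comp_lfunDr comp_lfunZr.
Qed.

Lemma star_ext (f g : subvs_of (homs P regmod)) :
  (forall p, vsval f p = vsval g p) -> f = g.
Proof. by move=> fg; apply: subvs_inj; apply/lfunP. Qed.

Lemma star_act_lin : linear star_act.
Proof.
move=> c a b; apply/lfunP => f; apply: star_ext => p.
rewrite add_lfunE scale_lfunE star_actE linearP /= add_lfunE scale_lfunE.
by rewrite !star_actE mulrDr scalerAr.
Qed.
Lemma star_act1 : star_act 1 = \1%VF.
Proof.
apply/lfunP => f; apply: star_ext => p.
by rewrite star_actE mulr1 id_lfunE.
Qed.
Lemma star_actM a b : star_act (a * b) = (star_act b \o star_act a)%VF.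
Proof.
apply/lfunP => f; apply: star_ext => p.
by rewrite comp_lfunE !star_actE mulrA.
Qed.
Definition star : rmod := Rmod star_act_lin star_act1 star_actM.
End Star.

Lemma precomp_img (P P' : lmod) (d : 'Hom(P', P)) : is_hom d ->
  forall b (x : star P'), x \in limg (precomp regmod d) ->
    ract (star P') b x \in limg (precomp regmod d).
Proof.
move=> hd b _ /memv_imgP[f _ ->]; apply/memv_imgP.
exists (ract (star P) b f); first exact: memvf.
apply: star_ext => p; rewrite -[ract (star P') b _]/(@star_act P' b _).
rewrite -[ract (star P) b _]/(@star_act P b _) star_actE !precompE // !comp_lfunE.
by rewrite star_actE.
Qed.

Definition Tr (M : lmod) : rmod := rquot (precomp_img (@mdiff_hom M 0)).

(* D Y = Hom_k(Y, k) with (b phi)(y) = phi(y b). *)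
Section Dual.
Variable Y : rmod.

Definition dual_act (b : B) : 'End('Hom(Y, k^o)) :=
  linfun (fun phi : 'Hom(Y, k^o) => (phi \o ract Y b)%VF).

Lemma dual_actE b (phi : 'Hom(Y, k^o)) y : dual_act b phi y = phi (ract Y b y).
Proof.
rewrite /dual_act linfunE ?comp_lfunE // => c f g.
by rewrite comp_lfunDl comp_lfunZl.
Qed.

Lemma dual_act_lin : linear dual_act.
Proof.
move=> c a b; apply/lfunP => phi; apply/lfunP => y.
rewrite add_lfunE scale_lfunE add_lfunE scale_lfunE !dual_actE ract_linv.
by rewrite linearP.
Qed.
Lemma dual_act1 : dual_act 1 = \1%VF.
Proof. by apply/lfunP => phi; apply/lfunP => y; rewrite dual_actE ract1v id_lfunE. Qed.
Lemma dual_actM a b : dual_act (a * b) = (dual_act a \o dual_act b)%VF.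
Proof.
apply/lfunP => phi; apply/lfunP => y.
by rewrite comp_lfunE !dual_actE ractMv.
Qed.
Definition dual : lmod := Lmod dual_act_lin dual_act1 dual_actM.
End Dual.

Definition tau (M : lmod) : lmod := dual (Tr M).

(* tau Omega^{n-1}; the value at n = 0 is a junk value. *)
Definition taun (n : nat) (M : lmod) : lmod := tau (syz n.-1 M).

End Modules.

Section Bimodules.
Variables (k : fieldType) (L : falgType k).

Lemma lmod_tens_ind (V : vectType k) (act : env L -> 'End(V)) :
  linear act ->
  (forall a b c d, act (tprod (a * c) (d * b)) =
     (act (tprod a b) \o act (tprod c d))%VF) ->
  forall s t, act (s * t) = (act s \o act t)%VF.
Proof.
move=> lin_act actM s t; move: s.
apply: tens_uniq => [c s1 s2|c s1 s2|a b].
- by rewrite [_ * t]emul_linl lin_act.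
- by rewrite lin_act comp_lfunDl comp_lfunZl.
move: t; apply: tens_uniq => [c t1 t2|c t1 t2|c d].
- by rewrite [_ * (_ + _)]emul_linr lin_act.
- by rewrite lin_act comp_lfunDr comp_lfunZr.
by rewrite -actM -emulE.
Qed.

(* Lambda as a bimodule: (a (x) b) x = a x b. *)
Definition bireg_act (t : env L) : 'End(L) :=
  linfun (fun x => text (fun a b => a * x * b) t).

Lemma bireg_bil x : bilinear (fun a b : L => a * x * b).
Proof.
split=> [b c a1 a2|a c b1 b2] /=.
  by rewrite !mulrDl -!scalerAl.
by rewrite mulrDr -scalerAr.
Qed.

Lemma bireg_actt t x : bireg_act t x = text (fun a b => a * x * b) t.
Proof.
rewrite /bireg_act linfunE // => c y z; rewrite /text scaler_sumr -big_split.
apply: eq_bigr => i _; rewrite scaler_sumr -big_split; apply: eq_bigr => j _ /=.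
rewrite mulrDr mulrDl -scalerAr -scalerAl scalerDr !scalerA.
by rewrite [c * _]mulrC.
Qed.

Lemma bireg_actE a b x : bireg_act (tprod a b) x = a * x * b.
Proof. by rewrite bireg_actt textE //; exact: bireg_bil. Qed.

Lemma bireg_act_lin : linear bireg_act.
Proof.
move=> c s t; apply/lfunP => x.
by rewrite add_lfunE scale_lfunE !bireg_actt linearP.
Qed.
Lemma bireg_act1 : bireg_act 1 = \1%VF.
Proof. by apply/lfunP => x; rewrite bireg_actE mul1r mulr1 id_lfunE. Qed.
Lemma bireg_actM s t : bireg_act (s * t) = (bireg_act s \o bireg_act t)%VF.
Proof.
apply: lmod_tens_ind => [|a b c d]; first exact: bireg_act_lin.
by apply/lfunP => x; rewrite comp_lfunE !bireg_actE !mulrA.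
Qed.
Definition bireg : lmod (env L) := Lmod bireg_act_lin bireg_act1 bireg_actM.

(* D X = Hom_k(X, k) for a bimodule X: (a phi b)(x) = phi(b x a). *)
Section BiDual.
Variable X : lmod (env L).

Definition eswap (t : env L) : env L := text (fun a b : L => tprod b a) t.

Lemma eswapE a b : eswap (tprod a b) = tprod b a.
Proof.
rewrite /eswap textE //; have [tl tr] := tprod_bilinear L L.
by split=> [b' c x y|a' c x y] /=; rewrite ?tr ?tl.
Qed.

Definition bidual_act (t : env L) : 'End('Hom(X, k^o)) :=
  linfun (fun phi : 'Hom(X, k^o) => (phi \o lact X (eswap t))%VF).

Lemma bidual_actE t (phi : 'Hom(X, k^o)) x :
  bidual_act t phi x = phi (lact X (eswap t) x).
Proof.
rewrite /bidual_act linfunE ?comp_lfunE // => c f g.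
by rewrite comp_lfunDl comp_lfunZl.
Qed.

Lemma bidual_act_lin : linear bidual_act.
Proof.
move=> c s t; apply/lfunP => phi; apply/lfunP => x.
rewrite add_lfunE scale_lfunE add_lfunE scale_lfunE !bidual_actE.
by rewrite /eswap linearP lact_linv linearP.
Qed.
Lemma bidual_act1 : bidual_act 1 = \1%VF.
Proof.
apply/lfunP => phi; apply/lfunP => x; rewrite bidual_actE eswapE.
by rewrite -[tprod 1 1]/(1 : env L) lact1v id_lfunE.
Qed.
Lemma bidual_actM s t : bidual_act (s * t) = (bidual_act s \o bidual_act t)%VF.
Proof.
apply: lmod_tens_ind => [|a b c d]; first exact: bidual_act_lin.
apply/lfunP => phi; apply/lfunP => x; rewrite comp_lfunE !bidual_actE !eswapE.
by rewrite -emulE -lactMv.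
Qed.
Definition bidual : lmod (env L) :=
  Lmod bidual_act_lin bidual_act1 bidual_actM.
End BiDual.

Definition HHtau_coh (X : lmod (env L)) (n : nat) : vectType k :=
  'Hom(subvs_of (homs X (taun n bireg)), k^o).

Definition HHtau_hom (X : lmod (env L)) (n : nat) : vectType k :=
  subvs_of (homs (bidual X) (taun n bireg)).

Definition graded_infinite (V : nat -> vectType k) : Prop :=
  forall N, exists2 n, (N <= n)%N & (\dim {:V n} != 0)%N.

Definition tau_Happel_positive : Prop :=
  infinite_gldim L /\ graded_infinite (HHtau_coh bireg).

Definition tau_Han_positive : Prop :=
  infinite_gldim L /\ graded_infinite (HHtau_hom bireg).

End Bimodules.

Section BoundQuiver.
Variables (k : fieldType) (Q : quiver) (L : bound_quiver_algebra k Q).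

Section Simples.
Variable x : vertex Q.

Definition simple_act (a : L) : 'End(k^o) := aug x a *: \1%VF.

Lemma simple_act_lin : linear simple_act.
Proof. by move=> c a b; rewrite /simple_act aug_lin scalerDl scalerA. Qed.
Lemma simple_act1 : simple_act 1 = \1%VF.
Proof. by rewrite /simple_act aug1 scale1r. Qed.
Lemma simple_actM a b : simple_act (a * b) = (simple_act a \o simple_act b)%VF.
Proof.
by rewrite /simple_act augM -comp_lfunZl -comp_lfunZr comp_lfun1l scalerA.
Qed.
Lemma simple_ractM a b : simple_act (a * b) = (simple_act b \o simple_act a)%VF.
Proof.
by rewrite /simple_act augM mulrC -comp_lfunZl -comp_lfunZr comp_lfun1l scalerA.
Qed.

Definition simple : lmod L := Lmod simple_act_lin simple_act1 simple_actM.
Definition rsimple : rmod L := Rmod simple_act_lin simple_act1 simple_ractM.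
End Simples.

Definition extension_conjecture : Prop :=
  forall u, loop_at u -> graded_infinite (fun n => Ext n (simple u) (simple u)).

(* y Lambda x <> 0. *)
Definition corner_neq0 (y x : vertex Q) : Prop :=
  exists a : L, idem L y * a * idem L x <> 0.

Definition infinite_plus_gldim : Prop :=
  exists y x, corner_neq0 y x /\
    graded_infinite (fun n => Tor n (rsimple x) (simple y)).

Definition infinite_coplus_gldim : Prop :=
  exists y x, corner_neq0 y x /\
    graded_infinite (fun n => Tor n (rsimple y) (simple x)).

End BoundQuiver.

(* Main.v *)
Require Import Defs.
From mathcomp Require Import all_boot all_order all_algebra all_field.
From Stdlib Require Import Classical.

Set Implicit Arguments.
Unset Strict Implicit.
Unset Printing Implicit Defensive.

Import GRing.Theory.
Local Open Scope ring_scope.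

(** Let [u] carry a loop and let [S] be the simple left module at [u]. The
    extension conjecture makes Ext(S, S) infinite, and everything is derived from
    this.

    Homs into [S] of a projective resolution are dual to its tensor product with
    the right simple module at [u], so Tor at the pair [(u, u)] is infinite too
    ([Tor_of_cocycle]). As [e_u] is not zero, the pair [(u, u)] witnesses both
    the infinite + and the infinite co+ global dimension. A nonzero class of
    degree [n] gives a nonzero map from the [n]-th minimal syzygy of [S] to [S];
    if [S] had finite projective dimension, its minimal syzygies would be
    eventually zero ([pdim_le_syz], [syz_zero]). So the global dimension is
    infinite.

    For the tau version, let [P] be the minimal bimodule resolution of [L] and
    [X] a bimodule. A map from [X] to [taun n L] is a functional on the space of
    maps from [P_n] to [X] that vanishes on those factoring through the
    differential. Since two successive differentials compose to zero, one of
    [taun n] and [taun (n - 1)] receives a nonzero map from [X] as soon as some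
    value [f(p)], for [f] a map from [P_n] to the enveloping algebra, does not
    annihilate [X] ([has_hom_taun]).

    To find such an [f] for [X = L] and [X = D L], consider the one-dimensional
    bimodule [T] on which both sides act through the augmentation at [u]. A
    nonzero map from [P_n] to [T] lifts to the enveloping algebra, and its values
    do not all annihilate the element [1] of [L] nor the augmentation in [D L]
    ([aug_lact_bireg], [aug_lact_bidual]). Nonzero maps to [T] exist in infinitely
    many degrees by the classical comparison of bimodule and one-sided
    resolutions: tensoring [P] over [L] with [S] gives a projective resolution of
    [S], because all syzygies of [L] are projective as right modules
    ([syz_right_projective], [coinvariant_ker], [coinvariant_projective]). Its
    syzygies contain the minimal ones as direct summands ([Omega_retract],
    [syz_simple_retract]), and so inherit their nonzero maps to [S]. *)

(** * Linear algebra *)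

Section LinearAlgebra.
Variable k : fieldType.
Implicit Types U V W : vectType k.

Lemma linear_ext V U (f g : V -> U) : linear f -> linear g ->
  (forall i, f (vb i) = g (vb i)) -> f =1 g.
Proof.
move=> lf lg fg v; rewrite (linear_expand lf) (linear_expand lg).
by apply: eq_bigr => i _; rewrite fg.
Qed.

Lemma linear_zero V U (f : V -> U) : linear f -> f 0 = 0.
Proof.
by move=> lf; have := lf (-1) 0 0; rewrite scaler0 addr0 scaleN1r addNr.
Qed.

Lemma linear_scale V U (f : V -> U) : linear f ->
  forall c v, f (c *: v) = c *: f v.
Proof. by move=> lf c v; have := lf c v 0; rewrite (linear_zero lf) !addr0. Qed.

Lemma dim_fullv_neq0 V : (\dim {:V} != 0)%N <-> exists v : V, v != 0.
Proof.
rewrite dimv_eq0; split=> [V0|[v v0]]; last first.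
  by apply: contraNneq v0 => V0; rewrite -memv0 -V0 memvf.
by exists (vpick {:V}); rewrite vpick0.
Qed.

Lemma limg_surj V W (f : 'Hom(V, W)) :
  limg f = fullv <-> forall y, exists x, f x = y.
Proof.
split=> [sf y|sf].
  have /memv_imgP[x _ ->] : y \in limg f by rewrite sf memvf.
  by exists x.
apply/eqP; rewrite eqEsubv subvf; apply/subvP => y _.
by have [x <-] := sf y; rewrite memv_img ?memvf.
Qed.

Lemma surj_endo_inj V (e : 'End(V)) : limg e = fullv -> lker e == 0%VS.
Proof.
move=> se; rewrite -dimv_eq0 -(eqn_add2r (\dim (limg e))) add0n.
by have := limg_ker_dim e fullv; rewrite capfv => ->; rewrite se.
Qed.

Lemma functional_neq0 V (v : V) : v != 0 -> exists l : 'Hom(V, k^o), l v != 0.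
Proof.
move=> v0; have [i vi] : exists i, vc i v != 0.
  apply/existsP; apply: contraNT v0; rewrite negb_exists => /forallP vi0.
  rewrite [v]vbE big1 // => i _.
  by have := vi0 i; rewrite negbK => /eqP ->; rewrite scale0r.
exists (linfun (vc i : V -> k^o)); rewrite linfunE //.
by move=> c x y; rewrite /vc linearP.
Qed.

Lemma dim_dual V :
  (\dim {:V} != 0)%N -> (\dim {:'Hom(V, k^o)} != 0)%N.
Proof.
move=> /dim_fullv_neq0[v /functional_neq0[l lv]]; apply/dim_fullv_neq0.
by exists l; apply: contraNneq lv => ->; rewrite zero_lfunE.
Qed.

(** A linear map that kills the kernel of [f] factors through [f]; the factor
    is its composite with a linear section of [f]. *)
Lemma factor_ker U V W (f : 'Hom(U, V)) (g : 'Hom(U, W)) :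
  (lker f <= lker g)%VS -> (g \o f^-1 \o f)%VF = g.
Proof.
move=> fg; apply/lfunP => x; rewrite !comp_lfunE.
apply/eqP; rewrite -subr_eq0 -linearB /= -memv_ker.
apply: (subvP fg); rewrite memv_ker linearB /= limg_lfunVK ?memv_img ?memvf //.
by rewrite subrr.
Qed.

End LinearAlgebra.

(** * Minimal projective resolutions *)

Section ProjectiveResolutions.
Variables (k : fieldType) (B : falgType k).
Implicit Types M N K P : lmod B.

Section Restriction.
Variables (M N : lmod B) (U : {vspace M}) (V : {vspace N}).
Variables (sU : smod U) (sV : smod V) (h : 'Hom(M, N)).
Hypothesis hUV : forall x, x \in U -> h x \in V.

Definition restr_hom : 'Hom(submod sU, submod sV) :=
  (corestr V \o h \o incl U)%VF.

Lemma incl_restr x : incl V (restr_hom x) = h (incl U x).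
Proof. by rewrite /restr_hom !comp_lfunE corestrK // hUV // incl_in. Qed.

Lemma restr_is_hom : is_hom h -> is_hom restr_hom.
Proof.
move=> hh b x; apply: (@incl_inj _ _ V).
by rewrite incl_restr (incl_hom (sU := sU)) hh (incl_hom (sU := sV)) incl_restr.
Qed.
End Restriction.

Lemma inv_hom M (e : 'Hom(M, M)) :
  is_hom e -> lker e == 0%VS -> is_hom (e^-1 : 'Hom(M, M))%VF.
Proof.
move=> he e0 b x; have /lker0P := e0; apply.
by rewrite he !lker0_lfunVK.
Qed.

(** This is the form in which the superfluous kernel of a projective cover is
    used: surjectivity onto the cover can be tested in the covered module. *)
Lemma cover_surj M (U : {vspace pc_mod (pcover M)}) : smod U ->
  (forall x, exists2 y, y \in U & pc_map (pcover M) y = pc_map (pcover M) x) ->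
  U = fullv.
Proof.
move=> sU Ux; apply: pc_superfluous sU _; apply/eqP; rewrite eqEsubv subvf.
apply/subvP => x _; have [y yU yx] := Ux x.
apply/memv_addP; exists y => //; exists (x - y); last by rewrite addrC subrK.
by rewrite memv_ker linearB /= yx subrr.
Qed.

Definition retract M K : Prop := exists (i : 'Hom(M, K)) (r : 'Hom(K, M)),
  [/\ is_hom i, is_hom r & forall x, r (i x) = x].

Lemma retract_refl M : retract M M.
Proof. by exists \1%VF, \1%VF; split=> [b x|b x|x]; rewrite !id_lfunE. Qed.

Lemma retract_projective M K : retract M K -> projective K -> projective M.
Proof.
move=> [i [r [hi hr ri]]] pK X Y g f hg sg hf.
have [h hh gh] := pK X Y g (f \o r)%VF hg sg (comp_hom hf hr).
exists (h \o i)%VF; first exact: comp_hom.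
by apply/lfunP => x; rewrite comp_lfunA gh !comp_lfunE ri.
Qed.

(** Half of Schanuel's lemma: lifting the section and the retraction to the
    projective modules gives an endomorphism of the cover of [M] above the
    identity, hence an automorphism, since the kernel is superfluous. *)
Lemma Omega_retract M K P (f : 'Hom(P, K)) (hf : is_hom f) :
  retract M K -> projective P -> limg f = fullv ->
  retract (Omega M) (kermod hf).
Proof.
move=> [i [r [hi hr ri]]] pP sf.
set c := pcover M; pose p := pc_map c; have hp : is_hom p := @pc_hom _ _ _ c.
have sp : limg p = fullv := pc_surj c.
have [s hs fs] := pc_projective hf sf (comp_hom hi hp).
have [t ht pt] := pP _ _ p (r \o f)%VF hp sp (comp_hom hr hf).
pose e : 'Hom(pc_mod c, pc_mod c) := (t \o s)%VF.
have he : is_hom e by apply: comp_hom.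
have pe x : p (e x) = p x.
  have /lfunP/(_ (s x)) := pt; rewrite !comp_lfunE => ->.
  by have /lfunP/(_ x) := fs; rewrite !comp_lfunE => ->; rewrite ri.
(* [e] is onto because it lies above the identity of [M]. *)
have e0 : lker e == 0%VS.
  apply/surj_endo_inj/cover_surj; first exact: img_smod.
  by move=> x; exists (e x); rewrite ?pe ?memv_img ?memvf.
have heV := inv_hom he e0.
have st x : x \in lker p -> s x \in lker f.
  rewrite !memv_ker => /eqP px.
  by have /lfunP/(_ x) := fs; rewrite !comp_lfunE px linear0 => ->.
have ts x : x \in lker f -> (e^-1 \o t)%VF x \in lker p.
  rewrite !memv_ker comp_lfunE => /eqP fx.
  have := pe ((e^-1)%VF (t x)); rewrite lker0_lfunVK // => <-.
  by have /lfunP/(_ x) := pt; rewrite !comp_lfunE fx linear0 => ->.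
exists (restr_hom (ker_smod hp) (ker_smod hf) s).
exists (restr_hom (ker_smod hf) (ker_smod hp) (e^-1 \o t)%VF); split.
- exact: restr_is_hom.
- by apply: restr_is_hom => //; apply: comp_hom.
move=> x; apply: (@incl_inj _ _ (lker p)).
rewrite (incl_restr _ ts) (incl_restr _ st) comp_lfunE.
by have := lker0_lfunK e0 (incl (lker p) x); rewrite /e comp_lfunE.
Qed.

Lemma syz_Omega n M : syz n (Omega M) = Omega (syz n M).
Proof. by elim: n => //= n ->. Qed.

(** The induction has to allow direct summands: a projective resolution of [K]
    need not be minimal, so minimal syzygies of [M] are only direct summands of
    the kernels that occur in it, even when [M] is [K] itself. *)
Lemma pdim_le_syz n K : pdim_le n K ->
  forall M, retract M K -> projective (syz n M).
Proof.
elim=> [{}K pK M|{}n P {}K f hf pP sf _ IHn M] rMK.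
  exact: retract_projective pK.
by rewrite /= -syz_Omega; apply: IHn; apply: Omega_retract.
Qed.

(** A section of the cover of a projective module has full image, because the
    kernel of the cover is superfluous; hence that kernel is zero. *)
Lemma Omega_projective M : projective M -> forall x : Omega M, x = 0.
Proof.
move=> pM x; set p := pc_map (pcover M).
have [s hs ps] := pM _ _ p \1%VF (@pc_hom _ _ _ _) (pc_surj _) (fun b y =>
  etrans (id_lfunE _) (congr1 _ (esym (id_lfunE _)))).
have psE y : p (s y) = y by have /lfunP/(_ y) := ps; rewrite comp_lfunE id_lfunE.
have sF : limg s = fullv.
  apply: cover_surj => [|y]; first exact: img_smod.
  by exists (s (p y)); rewrite ?psE ?memv_img ?memvf.
apply: (@incl_inj _ _ (lker p)); rewrite linear0.
have /memv_imgP[y _ yx] : incl (lker p) x \in limg s by rewrite sF memvf.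
have := incl_in x; rewrite yx memv_ker psE => /eqP ->.
by rewrite linear0.
Qed.

Lemma zero_projective M : (forall x : M, x = 0) -> projective M.
Proof.
move=> M0 X Y g f _ _ _; exists 0.
  by move=> b x; rewrite !zero_lfunE linear0.
by apply/lfunP => x; rewrite [x]M0 !linear0.
Qed.

Lemma syz_zero n m M : projective (syz n M) -> (n < m)%N ->
  forall x : syz m M, x = 0.
Proof.
move=> pM; elim: m => // m IHm; rewrite ltnS leq_eqVlt => /orP[/eqP <-|nm].
  exact: Omega_projective.
exact/Omega_projective/zero_projective/IHm.
Qed.

(** The homology spaces are realised inside the cocycles, as a complement of the
    coboundaries, so a nonzero class is already a cocycle; it only has to be
    moved out of the subspace of homomorphisms. *)
Lemma Ext_cocycle n M N : (\dim {:Ext n.+1 M N} != 0)%N ->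
  exists v : 'Hom(mres M n.+1, N),
    [/\ is_hom v, (v \o mdiff M n.+1)%VF = 0
      & forall w : 'Hom(mres M n, N), is_hom w -> (w \o mdiff M n)%VF <> v].
Proof.
move=> /dim_fullv_neq0[c c0].
have {c0} := c0; rewrite -(inj_eq (@subvs_inj _ _ _)) linear0.
have : vsval c \in (lker (precomp N (mdiff M n.+1))
  :\: limg (precomp N (mdiff M n)))%VS := subvsP c.
move: (vsval c) => v vD v0.
have /andP[]: (v \in lker (precomp N (mdiff M n.+1)))
  && (v \notin limg (precomp N (mdiff M n))).
  apply/andP; split; first exact: (subvP (diffvSl _ _)) vD.
  apply: contraNN v0 => vI; rewrite -memv0.
  by rewrite -(capv_diff (lker (precomp N (mdiff M n.+1)))
       (limg (precomp N (mdiff M n)))) memv_cap vI vD.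
rewrite memv_ker => /eqP vk vI; exists (vsval v); split.
- exact/homsP/subvsP.
- by rewrite -precompE ?vk ?linear0 //; exact: mdiff_hom.
move=> w /homsP hw wv; case/negP: vI; apply/memv_imgP.
exists (vsproj (homs (mres M n) N) w); first exact: memvf.
apply: subvs_inj; rewrite precompE; last exact: mdiff_hom.
by rewrite vsprojK.
Qed.

Lemma mdiff_img M n : limg (mdiff M n) = lker (pc_map (pcover (syz n M))).
Proof.
apply/eqP; rewrite eqEsubv; apply/andP; split; apply/subvP.
  by move=> _ /memv_imgP[x _ ->]; rewrite comp_lfunE incl_in.
move=> y yK; have [x xy] := (limg_surj _).1 (pc_surj (pcover (syz n.+1 M)))
  (corestr _ y).
apply/memv_imgP; exists x; first exact: memvf.
by rewrite comp_lfunE xy corestrK.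
Qed.

Lemma mdiff_comp M n x : mdiff M n (mdiff M n.+1 x) = 0.
Proof.
rewrite [mdiff M n]/mdiff comp_lfunE.
have : mdiff M n.+1 x \in lker (pc_map (pcover (syz n.+1 M))).
  by rewrite -mdiff_img memv_img ?memvf.
by rewrite memv_ker => /eqP ->; rewrite linear0.
Qed.

(** By exactness of the resolution a cocycle kills the kernel of the cover of the
    syzygy, so cocycles of degree [n] are maps defined on the syzygy. *)
Lemma cocycle_syz M N n (v : 'Hom(mres M n, N)) :
  is_hom v -> (v \o mdiff M n)%VF = 0 ->
  exists2 w : 'Hom(syz n M, N), is_hom w
    & (w \o pc_map (pcover (syz n M)))%VF = v.
Proof.
move=> hv v0; set p := pc_map _; have vp : (v \o p^-1 \o p)%VF = v.
  apply: factor_ker; rewrite -mdiff_img; apply/subvP => _ /memv_imgP[x _ ->].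
  by rewrite memv_ker -comp_lfunE v0 zero_lfunE.
exists (v \o p^-1)%VF => // b y; have [x <-] := (limg_surj p).1 (pc_surj _) y.
by rewrite -(pc_hom (p := pcover (syz n M))) -/p -!(comp_lfunE _ p) vp hv.
Qed.

End ProjectiveResolutions.

(** * Tor against a simple module *)

Section Tensor.
Variables (k : fieldType) (B : falgType k) (X : rmod B).
Implicit Types P : lmod B.

(** The universal property of the tensor product, for the relation subspace that
    defines it. *)
Lemma balanced_tensor_rel P (U : vectType k) (F : X -> P -> U) :
  Defs.bilinear F ->
  (forall b x p, F (ract X b x) p = F x (lact P b p)) ->
  forall t, t \in tensor_rel X P -> text F t = 0.
Proof.
move=> bF balF t tR; suff : t \in lker (linfun (text F)).
  by rewrite memv_ker lfunE => /eqP.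
move: tR; apply/subvP; rewrite /tensor_rel.
apply/subv_sumP => i _; apply/subv_sumP => b _; apply/subv_sumP => j _.
by rewrite -memvE memv_ker lfunE /= linearB /= !textE // balF subrr.
Qed.

(** The relations are imposed only for elements of the chosen bases; both sides
    are linear in each of the three variables. *)
Lemma tensorE P b x (p : P) :
  qproj (tensor_rel X P) (tprod (ract X b x) p)
  = qproj (tensor_rel X P) (tprod x (lact P b p)).
Proof.
have [tl tr] := tprod_bilinear X P.
move: b; apply: linear_ext => [c b b'|c b b'|b].
- by rewrite ract_linv tl linearP.
- by rewrite lact_linv tr linearP.
move: x; apply: linear_ext => [c x x'|c x x'|i].
- by rewrite linearP tl linearP.
- by rewrite tl linearP.
move: p; apply: linear_ext => [c p p'|c p p'|j].
- by rewrite tr linearP.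
- by rewrite linearP tr linearP.
apply: qproj_eq; rewrite memvE /tensor_rel.
by rewrite (sumv_sup i) // (sumv_sup b) // (sumv_sup j).
Qed.

Lemma tensor_mapE (P P' : lmod B) (d : 'Hom(P', P)) x p : is_hom d ->
  tensor_map X d (qproj (tensor_rel X P') (tprod x p))
  = qproj (tensor_rel X P) (tprod x (d p)).
Proof.
move=> hd; have [tl tr] := tprod_bilinear X P.
have bT : Defs.bilinear (fun (x : X) p => tprod x (d p) : tens X P).
  by split=> [y c y1 y2|y c y1 y2]; rewrite ?linearP ?tl ?tr.
rewrite /tensor_map (comp_lfunE (_ \o _)) (comp_lfunE (qproj _)).
rewrite [linfun (text _) _]lfunE -(textE bT); set s := tprod x p.
apply/eqP; rewrite -subr_eq0 -opprB oppr_eq0 -linearB -linearB /=; apply/eqP.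
have qT t : qproj (tensor_rel X P) (text (fun x p => tprod x (d p)) t)
    = text (fun x p => qproj (tensor_rel X P) (tprod x (d p))) t.
  by rewrite /text linear_sum; apply: eq_bigr => i _; rewrite linear_sum;
    apply: eq_bigr => j _; rewrite linearZ.
rewrite qT; apply: balanced_tensor_rel (qprojK _ _) => [|b y z].
  by split=> [y c y1 y2|y c y1 y2]; rewrite ?linearP ?tl ?tr ?linearP.
by rewrite tensorE hd.
Qed.
End Tensor.

Section Simple.
Variables (k : fieldType) (Q : quiver) (L : bound_quiver_algebra k Q).
Variable u : vertex Q.

Lemma lact_simple a (c : simple L u) : lact (simple L u) a c = aug u a *: c.
Proof.
by rewrite -[lact _ a]/(aug u a *: \1%VF : 'End(k^o)) scale_lfunE id_lfunE.
Qed.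

Lemma ract_simple a (c : rsimple L u) : ract (rsimple L u) a c = aug u a *: c.
Proof.
by rewrite -[ract _ a]/(aug u a *: \1%VF : 'End(k^o)) scale_lfunE id_lfunE.
Qed.

Lemma simple_homE (P : lmod L) (w : 'Hom(P, simple L u)) : is_hom w ->
  forall a p, w (lact P a p) = aug u a *: w p.
Proof. by move=> hw a p; rewrite hw lact_simple. Qed.

(** The functional [1 (x) p |-> v p] attached to a cocycle vanishes on the
    boundaries of the tensored resolution. Were all cycles boundaries, it would
    vanish on cycles, hence factor through the next differential, and the factor
    would exhibit [v] as a coboundary. *)
Lemma Tor_of_cocycle M n (v : 'Hom(mres M n.+1, simple L u)) :
  is_hom v -> (v \o mdiff M n.+1)%VF = 0 ->
  (forall w : 'Hom(mres M n, simple L u),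
     is_hom w -> (w \o mdiff M n)%VF <> v) ->
  (\dim {:Tor n.+1 (rsimple L u) M} != 0)%N.
Proof.
move=> hv vd nv; set X := rsimple L u.
pose f := tensor_map X (mdiff M n.+1); pose g := tensor_map X (mdiff M n).
rewrite -[Tor _ _ _]/(homology f g); apply/negP => /eqP H0.
have gf : (lker g <= limg f)%VS.
  by rewrite -diffv_eq0 -dimv_eq0; apply/eqP; rewrite -[RHS]H0 dimvf.
pose R := tensor_rel X (mres M n.+1).
pose F (c : X) (p : mres M n.+1) : k^o := c * v p.
have bF : Defs.bilinear F.
  split=> [y c y1 y2|y c y1 y2]; rewrite /F.
    by rewrite mulrDl -scalerAl.
  by rewrite linearP mulrDr -scalerAr.
have balF b x p : F (ract X b x) p = F x (lact (mres M n.+1) b p).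
  by rewrite /F (simple_homE hv) ract_simple -scalerAl -scalerAr.
pose psi : 'Hom(tensor X (mres M n.+1), k^o) :=
  (linfun (text F) \o qlift R)%VF.
have psiE c p : psi (qproj R (tprod c p)) = c * v p.
  rewrite /psi (comp_lfunE (linfun _)) [linfun (text _) _]lfunE.
  rewrite -[RHS](textE bF); apply/eqP; rewrite -subr_eq0 -linearB /=.
  rewrite -opprB linearN oppr_eq0; apply/eqP.
  exact: (balanced_tensor_rel bF balF (qprojK _ _)).
have psif : (limg f <= lker psi)%VS.
  apply/subvP => _ /memv_imgP[y _ ->]; rewrite memv_ker -comp_lfunE.
  rewrite -[y](qliftK (U := tensor_rel X _)); move: (qlift _ y) => {y} y.
  apply/eqP; rewrite comp_lfunE.
  move: y; apply: tens_uniq => [c s t|c s t|c p]; rewrite ?linearP //.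
    by rewrite scaler0 addr0.
  rewrite /f tensor_mapE; last exact: mdiff_hom.
  by rewrite psiE -comp_lfunE vd zero_lfunE mulr0.
have psig := factor_ker (subv_trans gf psif).
set chi := (psi \o _)%VF in psig.
pose R' := tensor_rel X (mres M n).
have lw : linear (fun p => chi (qproj R' (tprod (1 : X) p))).
  have [_ tr] := tprod_bilinear X (mres M n).
  by move=> c p p'; rewrite tr linearP linearP.
apply: (nv (linfun (fun p => chi (qproj R' (tprod (1 : X) p))))).
  move=> b p; rewrite !(linfunE lw) -tensorE.
  rewrite ract_simple lact_simple.
  have [tl _] := tprod_bilinear X (mres M n).
  by rewrite (linear_scale (tl p)) !linearZ.
apply/lfunP => p; rewrite comp_lfunE (linfunE lw).
rewrite -(tensor_mapE _ _ (@mdiff_hom _ _ M n)) -comp_lfunE psig.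
by rewrite psiE mul1r.
Qed.

End Simple.

(** * Maps into the translates of syzygies *)

Section Tau.
Variables (k : fieldType) (B : falgType k).
Implicit Types X M N : lmod B.

Definition has_hom M N : Prop := exists2 h : 'Hom(M, N), is_hom h & h != 0.

Lemma has_hom_dim M N :
  has_hom M N -> (\dim {:subvs_of (homs M N)} != 0)%N.
Proof.
move=> [h hh h0]; apply/dim_fullv_neq0; exists (vsproj (homs M N) h).
rewrite -(inj_eq (@subvs_inj _ _ _)) linear0 vsprojK //; exact/homsP.
Qed.

Section Evaluation.
Variables (X M : lmod B) (p : mres M 1) (l : 'Hom(X, k^o)).
Local Notation I := (limg (precomp (regmod B) (mdiff M 0))).

(** Pairing through a fixed element [p] and a fixed functional [l] replaces the
    duality between homomorphisms from [P] to [X] and the tensor product of the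
    dual of [P] with [X]. *)
Let ev (f : star (mres M 1)) (x : X) : k^o := l (lact X (vsval f p) x).

Let ev_linl x : linear (ev^~ x).
Proof.
move=> c f g; rewrite /ev linearP add_lfunE scale_lfunE lact_linv.
by rewrite linearP.
Qed.

Let ev_linr f : linear (ev f).
Proof. by move=> c x y; rewrite /ev !linearP. Qed.

(** A map from [X] to the dual of [Tr M] is a balanced pairing of [X] with the
    dual of [mres M 1] that vanishes on the image of the dual of [mres M 0]; the
    pairing [ev] is balanced because [b] acts on a dual by multiplying values on
    the right. *)
Lemma has_hom_tau :
  (forall (g : star (mres M 0)) x, l (lact X (vsval g (mdiff M 0 p)) x) = 0) ->
  (exists f x, ev f x != 0) -> has_hom X (tau M).
Proof.
move=> bd [f0 [x0 ev0]].
pose e x : 'Hom(Tr M, k^o) := (linfun (ev^~ x) \o qlift I)%VF.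
have eE x f : e x (qproj I f) = ev f x.
  rewrite /e (comp_lfunE (linfun _)) (linfunE (ev_linl x)).
  have /memv_imgP[g _ fg] := qprojK I f.
  have := ev_linl x (-1) (qlift I (qproj I f)) f.
  rewrite !scaleN1r ![- _ + _]addrC fg /ev precompE; last exact: mdiff_hom.
  by rewrite comp_lfunE bd => /esym/eqP; rewrite subr_eq0 => /eqP ->.
have le : linear e.
  move=> c x y; apply/lfunP; apply: quot_ind => f.
  by rewrite add_lfunE scale_lfunE !eE ev_linr.
exists (linfun e); last first.
  apply: contraNneq ev0 => /lfunP/(_ x0); rewrite linfunE // zero_lfunE.
  by move/lfunP/(_ (qproj I f0)); rewrite eE zero_lfunE => ->.
move=> b x; apply/lfunP; apply: quot_ind => f; rewrite !(linfunE le).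
rewrite -[lact (tau M) b]/(dual_act (Tr M) b) dual_actE.
rewrite -[ract (Tr M) b]/(@quot_act _ _ (star (mres M 1)) I b).
rewrite quot_actE; last exact/precomp_img/mdiff_hom.
rewrite !eE /ev -lactMv -[ract _ b]/(@star_act _ _ (mres M 1) b).
by rewrite star_actE.
Qed.
End Evaluation.

(** Because [d \o d = 0], a nonzero pairing with the degree [n] term of the
    resolution either vanishes on the image of the previous dual, giving a
    nonzero map to [taun n], or else, evaluated at [d p], it is a nonzero pairing
    in degree [n - 1], which vanishes on the image of the dual before it. *)
Lemma has_hom_taun n X M (f : star (mres M n.+2)) p x :
  lact X (vsval f p) x != 0 -> exists2 m, (n < m)%N & has_hom X (taun m M).
Proof.
move=> /functional_neq0[l lx].
have [[g [y gy]]|ng] := classic (exists (g : star (mres M n.+1)) y,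
    l (lact X (vsval g (mdiff M n.+1 p)) y) != 0).
  exists n.+1 => //.
  apply: (@has_hom_tau X (syz n M) (mdiff M n.+1 p) l); last by exists g, y.
  by move=> h z; rewrite -[mdiff (syz n M) 0]/(mdiff M n) mdiff_comp linear0
     (linear_zero (@lact_linv _ _ X z)) linear0.
exists n.+2 => //.
apply: (@has_hom_tau X (syz n.+1 M) p l); last by exists f, x.
move=> g y; apply/eqP; apply/negPn/negP => gy.
by apply: ng; exists g, y.
Qed.

End Tau.

(** * Bimodules projective on the right *)

Section RightProjective.
Variables (k : fieldType) (L : falgType k).
Implicit Types M N X Y P : lmod (env L).

Lemma lact_tprodE M (a b c d : L) x :
  lact M (tprod a b) (lact M (tprod c d) x) = lact M (tprod (a * c) (d * b)) x.
Proof. by rewrite -lactMv -emulE. Qed.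

Lemma biregE (a b c : L) : lact (bireg L) (tprod a b) (c : bireg L) = a * c * b.
Proof. exact: bireg_actE. Qed.

Lemma env_hom M N (f : 'Hom(M, N)) :
  (forall a b x, f (lact M (tprod a b) x) = lact N (tprod a b) (f x)) ->
  is_hom f.
Proof.
move=> fab s x; move: s; apply: tens_uniq => [c s t|c s t|a b //].
  by rewrite lact_linv linearP.
by rewrite lact_linv.
Qed.

Definition right_linear M N (f : 'Hom(M, N)) : Prop :=
  forall b x, f (lact M (tprod 1 b) x) = lact N (tprod 1 b) (f x).

Lemma hom_right_linear M N (f : 'Hom(M, N)) : is_hom f -> right_linear f.
Proof. by move=> hf b x; apply: hf. Qed.

Lemma comp_right_linear M N P (g : 'Hom(N, P)) (f : 'Hom(M, N)) :
  right_linear g -> right_linear f -> right_linear (g \o f)%VF.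
Proof. by move=> hg hf b x; rewrite !comp_lfunE hf hg. Qed.

(** Projectivity of the underlying right [L]-module, tested against right
    linear surjections between bimodules. *)
Definition right_projective M : Prop :=
  forall X Y (g : 'Hom(X, Y)) (f : 'Hom(M, Y)),
    right_linear g -> limg g = fullv -> right_linear f ->
    exists2 h : 'Hom(M, X), right_linear h & (g \o h)%VF = f.

Lemma right_projective_retract M N (i : 'Hom(M, N)) (r : 'Hom(N, M)) :
  right_linear i -> right_linear r -> (forall x, r (i x) = x) ->
  right_projective N -> right_projective M.
Proof.
move=> hi hr ri pN X Y g f hg sg hf.
have [h hh gh] := pN X Y g (f \o r)%VF hg sg (comp_right_linear hf hr).
exists (h \o i)%VF; first exact: comp_right_linear.
by apply/lfunP => x; rewrite comp_lfunA gh !comp_lfunE ri.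
Qed.

(** As a right module [L] is free on [1], so a lift is determined by a preimage
    of the image of [1]. *)
Lemma bireg_right_projective : right_projective (bireg L).
Proof.
move=> X Y g f hg sg hf.
have [x0 gx0] := (limg_surj g).1 sg (f (1 : L)).
have [tl tr] := tprod_bilinear L L.
have lh : linear (fun a : L => lact X (tprod 1 a) x0).
  by move=> c a b; rewrite tr lact_linv.
exists (linfun (fun a : L => lact X (tprod 1 a) x0) : 'Hom(bireg L, X)).
  by move=> b x; rewrite !(linfunE lh) lact_tprodE biregE !mul1r.
apply/lfunP => a; rewrite comp_lfunE (linfunE lh) hg gx0 -hf biregE.
by rewrite !mul1r.
Qed.

(** A free bimodule [(L (x) L) (x) V] is free as a right module on [L (x) V]:
    a right linear map is prescribed on the [(a (x) 1) (x) v]. *)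
Lemma freemod_right_projective (V : vectType k) :
  right_projective (freemod (env L) V).
Proof.
move=> X Y g f hg sg hf; have [tl tr] := tprod_bilinear L L.
have [el er] := tprod_bilinear (env L) V.
pose F (v : V) (a b : L) : X :=
  lact X (tprod 1 b) ((g^-1)%VF (f (tprod (tprod a 1 : env L) v))).
have bF v : Defs.bilinear (F v).
  split=> [b c a1 a2|a c b1 b2]; rewrite /F.
    by rewrite tl el !linearP.
  by rewrite tr lact_linv.
pose G (s : env L) (v : V) : X := text (F v) s.
have bG : Defs.bilinear G.
  split=> [v c s t|s c v w]; rewrite /G; first by rewrite linearP.
  move: s; apply: tens_uniq => [d s t|d s t|a b].
  - by rewrite linearP.
  - by rewrite !text_is_linear !scalerDr addrACA !scalerA [c * d]mulrC.
  by rewrite !textE // /F er !linearP.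
exists (linfun (text G) : 'Hom(freemod (env L) V, X)).
  move=> b; apply: tens_uniq => [c s t|c s t|s v]; rewrite ?linearP //.
  rewrite -[lact (freemod _ _) _]/(free_act V (tprod 1 b : env L)) free_actE.
  rewrite !lfunE /= !textE // /G.
  move: s; apply: tens_uniq => [c s t|c s t|a b'].
  - by rewrite mulrDr -scalerAr linearP.
  - by rewrite linearP linearP.
  rewrite -[_ * _]/(emul _ _) emulE !textE // /F lact_tprodE !mul1r.
  by [].
apply/lfunP; apply: tens_uniq => [c s t|c s t|s v]; rewrite ?linearP //.
rewrite comp_lfunE lfunE /= textE // /G.
move: s; apply: tens_uniq => [c s t|c s t|a b].
- by rewrite !linearP.
- by rewrite el linearP.
rewrite textE // /F hg limg_lfunVK ?sg ?memvf // -hf.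
rewrite -[lact (freemod _ _) _]/(free_act V (tprod 1 b : env L)) free_actE.
by rewrite -[_ * _]/(emul _ _) emulE !mul1r.
Qed.

Lemma projective_right_projective P : projective P -> right_projective P.
Proof.
move=> pP; pose F := freemod (env L) P.
pose p : 'Hom(F, P) := free_ext \1%VF.
have hp : is_hom p := @free_ext_hom _ _ _ _ _.
have sp : limg p = fullv.
  by apply/limg_surj => x; exists (tprod 1 x); rewrite free_extE lact1v id_lfunE.
have h1 : is_hom (\1%VF : 'Hom(P, P)) by move=> b x; rewrite !id_lfunE.
have [s hs ps] := pP F P p \1%VF hp sp h1.
apply: (right_projective_retract (hom_right_linear hs) (hom_right_linear hp)).
  by move=> x; rewrite -comp_lfunE ps id_lfunE.
exact: freemod_right_projective.
Qed.

Section Kernel.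
Variables (P M : lmod (env L)) (p : 'Hom(P, M)) (hp : is_hom p).
Hypotheses (sp : limg p = fullv) (pM : right_projective M).

(** The surjection [p] splits over the right structure, and a splitting gives a
    complementary projection onto its kernel. *)
Lemma ker_right_retraction : exists2 r : 'Hom(P, kermod hp), right_linear r &
  forall x : kermod hp, r (incl (lker p) x) = x.
Proof.
have h1 : right_linear (\1%VF : 'Hom(M, M)) by move=> b x; rewrite !id_lfunE.
have [s hs ps] := pM (hom_right_linear hp) sp h1.
have psE y : p (s y) = y by rewrite -comp_lfunE ps id_lfunE.
have rK x : x - s (p x) \in lker p.
  by rewrite memv_ker linearB /= psE subrr.
pose r : 'Hom(P, kermod hp) := (corestr (lker p) \o (\1 - (s \o p)%VF))%VF.
have rE x : incl (lker p) (r x) = x - s (p x).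
  by rewrite /r comp_lfunE add_lfunE opp_lfunE id_lfunE comp_lfunE corestrK.
exists r => [b x|x]; apply: (@incl_inj _ _ (lker p)); last first.
  rewrite rE; have := incl_in x; rewrite memv_ker => /eqP ->.
  by rewrite linear0 subr0.
rewrite rE (incl_hom (sU := ker_smod hp)) rE hp hs.
by rewrite linearB.
Qed.

Lemma ker_right_projective : right_projective P -> right_projective (kermod hp).
Proof.
have [r hr ri] := ker_right_retraction.
apply: right_projective_retract hr ri => b x.
exact: (incl_hom (sU := ker_smod hp)).
Qed.
End Kernel.

Lemma syz_right_projective n : right_projective (syz n (bireg L)).
Proof.
elim: n => [|n IHn] /=; first exact: bireg_right_projective.
apply: ker_right_projective => //; first exact: pc_surj.
exact/projective_right_projective/pc_projective.
Qed.

End RightProjective.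

(** * Coinvariants along the augmentation *)

Section Coinvariants.
Variables (k : fieldType) (Q : quiver) (L : bound_quiver_algebra k Q).
Variable u : vertex Q.
Implicit Types M P : lmod (env L).
Implicit Types N X Y : lmod L.

Lemma aug_linear : linear (aug u : L -> k^o).
Proof. by move=> c a b; rewrite aug_lin. Qed.

(** The subspace [M m] of a bimodule, where [m] is the kernel of the augmentation
    at [u]: the elements [b - aug u b] span [m] when [b] runs through a basis. *)
Definition aug_rad M : {vspace M} :=
  (\sum_(i < \dim {:L})
    limg (lact M (tprod 1 (vb i - aug u (vb i) *: 1 : L))))%VS.

Lemma tprod1_aug M (b : L) x :
  lact M (tprod 1 (b - aug u b *: 1)) x = lact M (tprod 1 b) x - aug u b *: x.
Proof.
have [_ tr] := tprod_bilinear L L.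
rewrite -scaleNr addrC tr lact_linv -[tprod 1 1]/(1 : env L) lact1v.
by rewrite addrC scaleNr.
Qed.

Lemma aug_radP M (b : L) x : lact M (tprod 1 b) x - aug u b *: x \in aug_rad M.
Proof.
have [_ tr] := tprod_bilinear L L.
rewrite -tprod1_aug.
have lf : linear (fun b : L => lact M (tprod 1 (b - aug u b *: 1)) x).
  move=> c a a'; rewrite !tprod1_aug tr lact_linv aug_lin scalerDl scalerBr.
  by rewrite scalerA addrACA opprD.
rewrite (linear_expand lf); apply: memv_suml => i _; apply: memvZ.
rewrite memvE /aug_rad (sumv_sup i) // -memvE.
exact: memv_img (memvf _).
Qed.

Lemma aug_rad_min M (U : {vspace M}) :
  (forall b x, lact M (tprod 1 b) x - aug u b *: x \in U) ->
  (aug_rad M <= U)%VS.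
Proof.
move=> sU; apply/subv_sumP => i _; apply/subvP => _ /memv_imgP[x _ ->].
by rewrite tprod1_aug.
Qed.

Lemma aug_rad_map M P (f : 'Hom(M, P)) : right_linear f ->
  forall x, x \in aug_rad M -> f x \in aug_rad P.
Proof.
move=> hf x xW; rewrite memv_preim; move: x xW; apply/subvP/aug_rad_min => b x.
by rewrite -memv_preim linearB linearZ /= hf aug_radP.
Qed.

Lemma aug_rad_lift M P (f : 'Hom(M, P)) : right_linear f -> limg f = fullv ->
  forall y, y \in aug_rad P -> exists2 x, x \in aug_rad M & f x = y.
Proof.
move=> hf sf y yW; suff /memv_imgP[x xW ->] : y \in (f @: aug_rad M)%VS.
  by exists x.
move: y yW; apply/subvP/aug_rad_min => b y.
have [x <-] := (limg_surj f).1 sf y.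
by rewrite -hf -linearZ -linearB memv_img ?aug_radP.
Qed.

(** [q] presents [N] as [M / M m], which is the tensor product of [M] over [L]
    with the simple left module at [u]. A predicate on [q] is used rather than a
    chosen quotient because the quotient of a kernel has to be recognised as a
    kernel again. *)
Definition coinvariant M N (q : 'Hom(M, N)) : Prop :=
  [/\ limg q = fullv, lker q = aug_rad M
    & forall a x, q (lact M (tprod a 1) x) = lact N a (q x)].

Section Quotient.
Variable M : lmod (env L).
Local Notation W := (aug_rad M).

Lemma left_aug_rad (a : L) x : x \in W -> lact M (tprod a 1) x \in W.
Proof.
apply: aug_rad_map => b y.
by rewrite !lact_tprodE !mul1r !mulr1.
Qed.

Definition coinv_act (a : L) : 'End(quotv W) :=
  (qproj W \o lact M (tprod a 1) \o qlift W)%VF.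

Lemma coinv_actE a x : coinv_act a (qproj W x) = qproj W (lact M (tprod a 1) x).
Proof.
rewrite /coinv_act (comp_lfunE (_ \o _)) (comp_lfunE (qproj W)).
apply/esym/qproj_eq.
by have := left_aug_rad a (qprojK W x); rewrite linearB.
Qed.

Lemma quotv_ind (P : quotv W -> Prop) :
  (forall x, P (qproj W x)) -> forall q, P q.
Proof. by move=> Pq q; rewrite -[q](@qliftK _ _ W). Qed.

Lemma coinv_act_lin : linear coinv_act.
Proof.
have [tl _] := tprod_bilinear L L.
move=> c a b; apply/lfunP; apply: quotv_ind => x.
by rewrite add_lfunE scale_lfunE !coinv_actE tl lact_linv linearP.
Qed.

Lemma coinv_act1 : coinv_act 1 = \1%VF.
Proof.
apply/lfunP; apply: quotv_ind => x; rewrite coinv_actE id_lfunE.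
by rewrite -[tprod 1 1]/(1 : env L) lact1v.
Qed.

Lemma coinv_actM a b : coinv_act (a * b) = (coinv_act a \o coinv_act b)%VF.
Proof.
apply/lfunP; apply: quotv_ind => x.
by rewrite (comp_lfunE (coinv_act a)) !coinv_actE lact_tprodE mulr1.
Qed.

Definition coinv : lmod L := Lmod coinv_act_lin coinv_act1 coinv_actM.

Lemma qproj_coinvariant : @coinvariant M coinv (qproj W).
Proof.
split=> [||a x].
- by apply/limg_surj => y; exists (qlift W y); exact: qliftK.
- by apply/vspaceP => x; rewrite memv_ker qproj_eq0.
by rewrite -[lact coinv a]/(coinv_act a) coinv_actE.
Qed.
End Quotient.

(** A left module [N] seen as a bimodule through the augmentation on the right,
    that is the space of linear maps from the simple module at [u] to [N]. *)
Section Twist.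
Variable N : lmod L.

Definition twist_act (t : env L) : 'End(N) :=
  linfun (fun x => text (fun a b => aug u b *: lact N a x) t).

Lemma twist_bil x : Defs.bilinear (fun a b : L => aug u b *: lact N a x).
Proof.
split=> [b c a1 a2|a c b1 b2] /=.
  by rewrite lact_linv scalerDr !scalerA mulrC.
by rewrite aug_lin scalerDl scalerA.
Qed.

Lemma twist_actt t x :
  twist_act t x = text (fun a b => aug u b *: lact N a x) t.
Proof.
rewrite /twist_act linfunE // => c y z.
rewrite /text scaler_sumr -big_split.
apply: eq_bigr => i _; rewrite scaler_sumr -big_split; apply: eq_bigr => j _ /=.
by rewrite linearP !scalerDr !scalerA ![c * _]mulrC mulrAC.
Qed.

Lemma twist_actE a b x : twist_act (tprod a b) x = aug u b *: lact N a x.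
Proof. by rewrite twist_actt textE //; exact: twist_bil. Qed.

Lemma twist_act_lin : linear twist_act.
Proof.
move=> c s t; apply/lfunP => x.
by rewrite add_lfunE scale_lfunE !twist_actt linearP.
Qed.
Lemma twist_act1 : twist_act 1 = \1%VF.
Proof.
apply/lfunP => x; rewrite -[1]/(tprod 1 1) twist_actE aug1 scale1r lact1v.
by rewrite id_lfunE.
Qed.
Lemma twist_actM s t : twist_act (s * t) = (twist_act s \o twist_act t)%VF.
Proof.
apply: lmod_tens_ind => [|a b c d]; first exact: twist_act_lin.
apply/lfunP => x; rewrite comp_lfunE !twist_actE linearZ /= scalerA augM.
by rewrite [aug u b * _]mulrC lactMv.
Qed.
Definition twist : lmod (env L) := Lmod twist_act_lin twist_act1 twist_actM.

Lemma lact_twist a b (x : twist) :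
  lact twist (tprod a b) x = aug u b *: lact N a x.
Proof. exact: twist_actE. Qed.
End Twist.

Lemma twist_hom X Y (f : 'Hom(X, Y)) :
  is_hom f -> is_hom (f : 'Hom(twist X, twist Y)).
Proof.
by move=> hf; apply: env_hom => a b x; rewrite !lact_twist linearZ /= hf.
Qed.

Lemma coinvariant_hom M N (q : 'Hom(M, N)) :
  coinvariant q -> is_hom (q : 'Hom(M, twist N)).
Proof.
move=> [_ kq hq]; apply: env_hom => a b x; rewrite lact_twist -hq.
have -> : lact M (tprod a b) x = lact M (tprod 1 b) (lact M (tprod a 1) x).
  by rewrite lact_tprodE !mul1r.
apply/eqP; rewrite -subr_eq0 -linearZ -linearB /= -memv_ker kq.
exact: aug_radP.
Qed.

(** The twist is right adjoint to the coinvariants and is exact, so coinvariants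
    preserve projectivity. *)
Lemma coinvariant_projective P N (q : 'Hom(P, N)) :
  coinvariant q -> projective P -> projective N.
Proof.
move=> cq pP X Y g f hg sg hf; have [sq kq hq] := cq.
have [h hh gh] := pP (twist X) (twist Y) g (f \o q)%VF (twist_hom hg) sg
  (comp_hom (twist_hom hf) (coinvariant_hom cq)).
have hW : (lker q <= lker h)%VS.
  rewrite kq; apply: aug_rad_min => b x.
  rewrite memv_ker linearB subr_eq0; apply/eqP.
  apply: etrans (hh _ _) _; rewrite lact_twist lact1v.
  exact/esym/linearZ.
have hqE := factor_ker hW; set h' := (h \o _)%VF in hqE.
have hqv x : h' (q x) = h x by have /lfunP/(_ x) := hqE; rewrite comp_lfunE.
exists h'.
  move=> a y; have [x <-] := (limg_surj q).1 sq y.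
  rewrite -hq !hqv; apply: etrans (hh _ _) _.
  by rewrite lact_twist aug1 scale1r.
apply/lfunP => y; have [x <-] := (limg_surj q).1 sq y.
rewrite comp_lfunE hqv; have /lfunP/(_ x) := gh.
by rewrite !comp_lfunE.
Qed.

(** Coinvariants of a short exact sequence [K -> P -> M] stay exact when [M] is
    right projective: a right linear retraction of [P] onto [K] shows that an
    element of [K] lying in [P m] already lies in [K m]. *)
Lemma coinvariant_ker P M N (p : 'Hom(P, M)) (hp : is_hom p) (q : 'Hom(M, N)) :
  right_projective M -> projective P -> limg p = fullv -> coinvariant q ->
  exists (P' : lmod L) (p' : 'Hom(P', N)) (hp' : is_hom p')
    (q' : 'Hom(kermod hp, kermod hp')),
    [/\ projective P', limg p' = fullv & coinvariant q'].
Proof.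
move=> rM pP sp [sq kq hq].
have [P' [c cP]] : exists (P' : lmod L) (c : 'Hom(P, P')), coinvariant c.
  by exists (coinv P), (qproj (aug_rad P)); exact: qproj_coinvariant.
have [sc kc hc] := cP.
have hpr : right_linear p by apply: hom_right_linear.
have pcE : ((q \o p) \o c^-1 \o c = q \o p)%VF.
  apply: factor_ker; rewrite kc; apply/subvP => x xW.
  by rewrite memv_ker comp_lfunE -memv_ker kq aug_rad_map.
set p' : 'Hom(P', N) := (_ \o c^-1)%VF in pcE.
have p'E x : p' (c x) = q (p x) by rewrite -comp_lfunE pcE comp_lfunE.
have hp' : is_hom p'.
  move=> a y; have [x <-] := (limg_surj c).1 sc y.
  by rewrite -hc !p'E hp hq.
have ck x : x \in lker p -> c x \in lker p'.
  by rewrite !memv_ker p'E => /eqP ->; rewrite linear0.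
pose q' : 'Hom(kermod hp, kermod hp') :=
  (corestr (lker p') \o c \o incl (lker p))%VF.
have q'E x : incl (lker p') (q' x) = c (incl (lker p) x).
  rewrite /q' (comp_lfunE (_ \o _)) (comp_lfunE (corestr _)) corestrK //.
  by rewrite ck ?incl_in.
exists P', p', hp', q'; split.
- exact: coinvariant_projective cP pP.
- apply/limg_surj => z; have [y <-] := (limg_surj q).1 sq z.
  by have [x <-] := (limg_surj p).1 sp y; exists (c x); rewrite p'E.
split=> [||a x].
- apply/limg_surj => y; have [x cx] := (limg_surj c).1 sc (incl (lker p') y).
  have := incl_in y; rewrite -cx memv_ker p'E -memv_ker kq.
  move=> /(aug_rad_lift hpr sp)[w wW wx].
  have xw : x - w \in lker p by rewrite memv_ker linearB /= wx subrr.
  exists (corestr (lker p) (x - w)); apply: (@incl_inj _ _ (lker p')).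
  rewrite q'E corestrK // linearB /= cx.
  by move: wW; rewrite -kc memv_ker => /eqP ->; rewrite subr0.
- have [r hr ri] := ker_right_retraction hp sp rM.
  apply/eqP; rewrite eqEsubv; apply/andP; split.
    apply/subvP => x; rewrite memv_ker -(inj_eq (@incl_inj _ _ (lker p'))).
    rewrite q'E linear0 -memv_ker kc => /(aug_rad_map hr).
    by rewrite ri.
  apply/subvP => x xW; rewrite memv_ker -(inj_eq (@incl_inj _ _ (lker p'))).
  rewrite q'E linear0 -memv_ker kc.
  apply: (@aug_rad_map (kermod hp)) xW; apply: hom_right_linear.
  exact: (incl_hom (sU := ker_smod hp)).
apply: (@incl_inj _ _ (lker p')).
rewrite q'E (incl_hom (sU := ker_smod hp)) (incl_hom (sU := ker_smod hp')).
by rewrite q'E hc.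
Qed.

(** This starts the comparison of syzygies. An [x] of augmentation zero lies in
    [L m] because [x = 1 x]. *)
Lemma aug_coinvariant :
  @coinvariant (bireg L) (simple L u) (linfun (aug u : L -> k^o)).
Proof.
split=> [||a x].
- apply/limg_surj => c; exists (c *: (1 : L)); rewrite (linfunE aug_linear).
  by rewrite (linear_scale aug_linear) aug1 [LHS]mulr1.
- apply/eqP; rewrite eqEsubv; apply/andP; split.
    apply/subvP => x; rewrite memv_ker (linfunE aug_linear) => /eqP x0.
    have := aug_radP (M := bireg L) x (1 : L).
    by rewrite x0 scale0r subr0 biregE !mul1r.
  apply: aug_rad_min => b x; rewrite memv_ker (linfunE aug_linear) biregE mul1r.
  rewrite addrC -scaleNr aug_linear augM scaleNr.
  by rewrite [X in - X + _]/(_ * _) mulrC addNr.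
by rewrite !(linfunE aug_linear) biregE mulr1 augM lact_simple.
Qed.

(** The coinvariants of the syzygies of the bimodule [L] are, step by step,
    syzygies of the simple module, not necessarily minimal ones; the minimal
    ones are their direct summands. *)
Lemma syz_simple_retract n : exists N (q : 'Hom(syz n (bireg L), N)),
  coinvariant q /\ retract (syz n (simple L u)) N.
Proof.
elim: n => [|n [N [q [cq rN]]]] /=.
  exists (simple L u), (linfun (aug u : L -> k^o)); split.
    exact: aug_coinvariant.
  exact: retract_refl.
have [P' [p' [hp' [q' [pP' sp' cq']]]]] := coinvariant_ker
  (@pc_hom _ _ _ (pcover (syz n (bireg L)))) (syz_right_projective (n := n))
  (@pc_projective _ _ _ _) (pc_surj _) cq.
exists (kermod hp'), q'; split=> //.
exact: Omega_retract.
Qed.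

(** A nonzero map from the syzygy of the simple module extends to the coinvariants
    of the syzygy of [L], hence gives a nonzero bimodule map from the resolution
    of [L] to the one-dimensional bimodule [twist (simple L u)]. Projectivity
    lifts it along [s |-> s 1] to a map into the enveloping algebra. *)
Lemma bimodule_pairing n : has_hom (syz n (simple L u)) (simple L u) ->
  exists (f : star (mres (bireg L) n)) p,
    lact (twist (simple L u)) (vsval f p) (1 : k^o) != 0.
Proof.
move=> [w hw w0]; have [N [q [cq [i [r [hi hr ri]]]]]] := syz_simple_retract n.
have [sq _ _] := cq.
set c := pcover (syz n (bireg L)).
pose S := twist (simple L u).
pose v : 'Hom(mres (bireg L) n, S) := ((w \o r) \o q \o pc_map c)%VF.
have hv : is_hom v.
  apply: comp_hom (@pc_hom _ _ _ c).
  exact: (comp_hom (twist_hom (comp_hom hw hr)) (coinvariant_hom cq)).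
pose g : 'Hom(regmod (env L), S) :=
  linfun (fun s : env L => lact S s (1 : k^o)).
have gE s : g s = lact S s (1 : k^o) by rewrite linfunE //; exact: lact_linv.
have hg : is_hom g.
  move=> s t; rewrite !gE -lactMv; congr (lact S _ _); exact: reg_actE.
have sg : limg g = fullv.
  apply/limg_surj => x; exists (x *: (1 : env L)); rewrite linearZ /= gE lact1v.
  exact: mulr1.
have [f /homsP hf gf] := pc_projective (p := c) hg sg hv.
have [x wx] : exists x, w x != 0.
  apply: NNPP => nx; case/eqP: w0; apply/lfunP => x; rewrite zero_lfunE.
  by apply/eqP/negPn/negP => wx; apply: nx; exists x.
have [y qy] := (limg_surj q).1 sq (i x).
have [p py] := (limg_surj (pc_map c)).1 (pc_surj _) y.
exists (vsproj (homs _ (regmod (env L))) f), p.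
rewrite vsprojK // -gE -comp_lfunE gf /v.
by rewrite (comp_lfunE (_ \o _)) (comp_lfunE (w \o r)%VF) py qy comp_lfunE ri.
Qed.

(** These two identities show that an element of the enveloping algebra acting
    nontrivially on [twist (simple L u)] cannot annihilate [L] nor its dual. *)
Lemma aug_lact_bireg s :
  (aug u (lact (bireg L) s (1 : L)) : k^o)
  = lact (twist (simple L u)) s (1 : k^o).
Proof.
move: s; apply: tens_uniq => [c s t|c s t|a b].
- by rewrite lact_linv aug_linear.
- exact: (@lact_linv _ _ (twist (simple L u)) (1 : k^o) c s t).
by rewrite biregE lact_twist lact_simple augM mulr1 mulrC scalerA [RHS]mulr1.
Qed.

Lemma aug_lact_bidual s :
  lact (bidual (bireg L)) s (linfun (aug u : L -> k^o)) (1 : L)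
  = lact (twist (simple L u)) s (1 : k^o).
Proof.
rewrite -aug_lact_bireg -[lact (bidual _) s]/(bidual_act (bireg L) s).
rewrite bidual_actE (linfunE aug_linear).
move: s; apply: tens_uniq => [c s t|c s t|a b].
- by rewrite /eswap linearP lact_linv aug_linear.
- by rewrite lact_linv aug_linear.
by rewrite eswapE !biregE !mulr1 !augM mulrC.
Qed.

End Coinvariants.

(** * Infinite self-extensions of a simple module *)

Section Loop.
Variables (k : fieldType) (Q : quiver) (L : bound_quiver_algebra k Q).
Variable u : vertex Q.
Local Notation S := (simple L u).

Hypothesis infE : graded_infinite (fun n => Ext n S S).

Lemma corner_self : corner_neq0 L u u.
Proof.
exists 1 => /(congr1 (aug u)); rewrite !augM aug1 mulr1.
have -> : aug u (idem L u) = 1 by rewrite /idem augE epsE eqxx.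
rewrite mulr1 (linear_zero (@aug_linear _ _ L u)) => /eqP.
by rewrite oner_eq0.
Qed.

Lemma infinite_Tor : graded_infinite (fun n => Tor n (rsimple L u) S).
Proof.
move=> N; have [[|n] Nn En] := infE N.+1; first by [].
exists n.+1; first exact: ltnW.
by have [v [hv vd nv]] := Ext_cocycle En; apply: Tor_of_cocycle vd nv.
Qed.

Lemma infinite_syz_hom N : exists2 n, (N <= n)%N & has_hom (syz n S) S.
Proof.
have [[|n] Nn En] := infE N.+1; first by [].
exists n.+1; first exact: ltnW.
have [v [hv vd nv]] := Ext_cocycle En; have [w hw wv] := cocycle_syz hv vd.
exists w => //; apply/eqP => w0; apply: (nv 0).
  by move=> b x; rewrite !zero_lfunE linear0.
by rewrite -wv w0 !comp_lfun0l.
Qed.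

Lemma infinite_gldim_simple : infinite_gldim L.
Proof.
move=> n; exists S => /pdim_le_syz/(_ _ (retract_refl S)) pS.
have [m nm [w _ /eqP]] := infinite_syz_hom n.+1; case.
by apply/lfunP => x; rewrite (syz_zero pS nm x) !linear0.
Qed.

(** A pairing found in degree [n] yields a map in degree [n] or [n - 1], so the
    degrees obtained are still unbounded. *)
Lemma infinite_taun_hom (X : lmod (env L)) x :
  (forall s, lact (twist u S) s (1 : k^o) != 0 -> lact X s x != 0) ->
  graded_infinite (fun n => subvs_of (homs X (taun n (bireg L)))).
Proof.
move=> Xs N; have [[|[|n]] Nn /bimodule_pairing[f [p fp]]] :=
  infinite_syz_hom N.+2; try by [].
have [m nm hm] := has_hom_taun (Xs _ fp); exists m; last exact: has_hom_dim.
by rewrite ltnW // (leq_trans _ nm).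
Qed.

Lemma tau_Happel_simple : tau_Happel_positive L.
Proof.
split; first exact: infinite_gldim_simple.
move=> N; have [s|n Nn hn] := @infinite_taun_hom (bireg L) (1 : L) _ N.
  rewrite -aug_lact_bireg; apply: contraNneq => ->.
  by rewrite (linear_zero (@aug_linear _ _ L u)).
by exists n => //; apply: dim_dual.
Qed.

Lemma tau_Han_simple : tau_Han_positive L.
Proof.
split; first exact: infinite_gldim_simple.
apply: (@infinite_taun_hom (bidual (bireg L)) (linfun (aug u : L -> k^o))) => s.
by rewrite -aug_lact_bidual; apply: contraNneq => ->; rewrite zero_lfunE.
Qed.
End Loop.

Theorem proposition6p11 (k : fieldType) (Q : quiver)
    (L : bound_quiver_algebra k Q)
    (loopQ : exists u : vertex Q, loop_at u)
    (extL : extension_conjecture L) :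
  (infinite_plus_gldim L /\ infinite_coplus_gldim L) /\
  (tau_Han_positive L /\ tau_Happel_positive L).
Proof.
have [u /extL infE] := loopQ; split; split.
- by exists u, u; split; [apply: corner_self | apply: infinite_Tor].
- by exists u, u; split; [apply: corner_self | apply: infinite_Tor].
- exact: tau_Han_simple infE.
- exact: tau_Happel_simple infE.
Qed.
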